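(* Let $k$ be a field, let $G$ be a finite group, let $\mathcal L_0$ be a set and let $V=\{{}_yV_x\}_{x,y\in\mathcal L_0}$ be a family of $kG$-modules which are finite dimensional as $k$-vector spaces. Let $G$ act on the free $k$-category $\mathcal L_k(V)$ by the induced homogeneous action. For each oriented path $\gamma$ of positive length in the track-quiver $Q$ of $\mathcal L_k(V)$ choose a space of irreducible invariants $[V_\gamma^G]_{\mathsf{irr}}$, and let $U=\{{}_yU_x\}_{x,y\in\mathcal L_0}$ be the family $${}_yU_x=\bigoplus_{\gamma}[V_\gamma^G]_{\mathsf{irr}},$$ where $\gamma$ runs over the oriented paths of positive length of $Q$ from $x$ to $y$. Then the functor $F:\mathcal L_k(U)\to\mathcal L_k(V)^G$ which is the identity on objects and is determined, through the universal property of $\mathcal L_k(U)$, by the inclusions ${}_yU_x\subseteq{}_y[\mathcal L_k(V)^G]_x$, is an isomorphism of categories.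
   Context: A $k$-category is a small category whose morphism sets are $k$-vector spaces and whose composition is $k$-bilinear; ${}_y\mathcal C_x$ is the space of morphisms from $x$ to $y$. Free $k$-category: for a set $\mathcal L_0$ and a family of $k$-vector spaces $V=\{{}_yV_x\}_{x,y\in\mathcal L_0}$, the category $\mathcal L_k(V)$ has set of objects $\mathcal L_0$ and morphisms from $x$ to $y$ given by $\bigoplus_u W(u)$, where $u=(y=u_n,u_{n-1},\dots,u_0=x)$ runs over all finite sequences in $\mathcal L_0$ from $x$ to $y$ and $W(u)={}_{u_n}V_{u_{n-1}}\otimes_k\cdots\otimes_k{}_{u_1}V_{u_0}$, with $W(u_0)=k$ for a singleton sequence. Composition is the direct sum of the tensoring maps $W(v)\otimes W(u)\to W(vu)$, where $vu$ is the concatenation of sequences (identifying the last object of $u$ with the first object of $v$). Universal property: a $k$-linear functor from $\mathcal L_k(V)$ to a $k$-category $\mathcal B$ is uniquely determined by a map $F_0$ on objects and linear maps ${}_yV_x\to{}_{F_0(y)}\mathcal B_{F_0(x)}$. Homogeneous action: given linear actions of $G$ on each ${}_yV_x$, $G$ acts on $\mathcal L_k(V)$ by invertible $k$-linear endofunctors which are the identity on objects and are given by the diagonal action on each $W(u)$ (trivial on $W(u_0)=k$). $\mathcal L_k(V)^G$ is the subcategory with the same objects and with morphism spaces the $G$-fixed morphisms. The track-quiver $Q$ of $\mathcal L_k(V)$ has vertices $\mathcal L_0$ and exactly one arrow from $x$ to $y$ if ${}_yV_x\ne0$, none otherwise. For an oriented path $\gamma$ of $Q$, $u_n\leftarrow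 u_{n-1}\leftarrow\cdots\leftarrow u_0$, put $V_\gamma={}_{u_n}V_{u_{n-1}}\otimes\cdots\otimes{}_{u_1}V_{u_0}$, a $kG$-module with the diagonal action. Composite and irreducible invariants: for $kG$-modules $M_n,\dots,M_1$, the space of composite invariants $[(M_n\otimes\cdots\otimes M_1)^G]^2$ is the sum over $i=1,\dots,n-1$ of the images of the canonical maps $(M_n\otimes\cdots\otimes M_{i+1})^G\otimes(M_i\otimes\cdots\otimes M_1)^G\to(M_n\otimes\cdots\otimes M_1)^G$ (zero if $n=1$). For a path $\gamma$ of positive length, $[V_\gamma^G]^2$ is this subspace for the sequence of tensor factors of $V_\gamma$, and a space of irreducible invariants $[V_\gamma^G]_{\mathsf{irr}}$ is an arbitrarily chosen vector space complement, so that $V_\gamma^G=[V_\gamma^G]_{\mathsf{irr}}\oplus[V_\gamma^G]^2$. *)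

(* Defs.v *)
From HB Require Import structures.
From mathcomp Require Import all_boot all_order all_algebra all_fingroup.
From mathcomp Require Import generic_quotient ring_quotient.
From mathcomp Require Import finmap all_classical.

Set Implicit Arguments.
Unset Strict Implicit.
Unset Printing Implicit Defensive.

Import GRing.Theory.
Local Open Scope classical_set_scope.
Local Open Scope quotient_scope.
Local Open Scope ring_scope.

Definition mklin (k : fieldType) (M N : lmodType k) (f : M -> N)
    (lin : linear f) : {linear M -> N} :=
  HB.pack f (GRing.isLinear.Build k M N *:%R f lin).

Lemma mklinE (k : fieldType) (M N : lmodType k) (f : M -> N) (lin : linear f) x :
  mklin lin x = f x.
Proof. by []. Qed.

Section Subspaces.
Variables (k : fieldType) (M : lmodType k).

Record submod (S : submodClosed M) : Type :=
  Submod { submod_val : M; submod_valP : submod_val \in S }.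
HB.instance Definition _ (S : submodClosed M) := [isSub for @submod_val S].
HB.instance Definition _ (S : submodClosed M) := [Choice of submod S by <:].
HB.instance Definition _ (S : submodClosed M) :=
  [SubChoice_isSubLmodule of submod S by <:].

(* The smallest subspace containing A. *)
Definition lspan (A : set M) : {pred M} := fun x =>
  `[< forall S : submodClosed M, (forall y, A y -> y \in S) -> x \in S >].

Fact lspan_closed (A : set M) : GRing.subsemimod_closed (lspan A).
Proof.
split; first split.
- by apply/asboolP => S _; exact: rpred0.
- move=> x y /asboolP hx /asboolP hy; apply/asboolP => S hS.
  by rewrite rpredD ?hx ?hy.
- by move=> a x /asboolP hx; apply/asboolP => S hS; rewrite rpredZ ?hx.
Qed.
HB.instance Definition _ (A : set M) :=
  GRing.isSubSemiModClosed.Build k M (lspan A) (lspan_closed A).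

Lemma mem_lspan (A : set M) x : A x -> x \in lspan A.
Proof. by move=> Ax; apply/asboolP => S; exact. Qed.

Lemma lspan_min (A : set M) (S : submodClosed M) x :
  (forall y, A y -> y \in S) -> x \in lspan A -> x \in S.
Proof. by move=> h /asboolP; exact. Qed.

Definition internal_direct_sum (S A B : {pred M}) : Prop :=
  (forall x, x \in S <-> exists a b, [/\ a \in A, b \in B & x = a + b]) /\
  (forall x, x \in A -> x \in B -> x = 0).

Section Kernel.
Variables (N : lmodType k) (f : {linear M -> N}).
Definition lin_ker : {pred M} := fun x => f x == 0.
Fact lin_ker_closed : GRing.subsemimod_closed lin_ker.
Proof.
split; first split.
- by rewrite unfold_in linear0.
- by move=> x y /eqP hx /eqP hy; rewrite unfold_in linearD hx hy addr0.
- by move=> a x /eqP hx; rewrite unfold_in linearZ /= hx scaler0.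
Qed.
HB.instance Definition _ :=
  GRing.isSubSemiModClosed.Build k M lin_ker lin_ker_closed.
End Kernel.

End Subspaces.

Section QuotientSpace.
Variables (k : fieldType) (M : lmodType k) (S : submodClosed M).

Definition submod_zmod : {pred M} := fun x => x \in S.
Fact submod_zmod_closed : GRing.zmod_closed submod_zmod.
Proof. exact: GRing.submod_closedB (GRing.submodClosedP S). Qed.
HB.instance Definition _ := GRing.isZmodClosed.Build M submod_zmod submod_zmod_closed.

Definition lquot : Type := Quotient.quot submod_zmod.
HB.instance Definition _ := EqQuotient.on lquot.
HB.instance Definition _ := GRing.Zmodule.on lquot.

Lemma lquot_eqP (x y : M) : reflect (x = y %[mod lquot]) (x - y \in S).
Proof.
have -> : (x - y \in S) = (x - y \in submod_zmod) by [].
by rewrite Quotient.idealrBE; apply: (iffP eqP).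
Qed.

Definition lquot_scale (a : k) (x : lquot) : lquot := \pi_lquot (a *: repr x).

Lemma pi_scale a x : \pi_lquot (a *: x) = lquot_scale a (\pi_lquot x).
Proof.
apply/lquot_eqP; rewrite -scalerBr rpredZ //; apply/lquot_eqP.
by rewrite reprK.
Qed.

Lemma pi_add (x y : M) : \pi_lquot (x + y) = \pi_lquot x + \pi_lquot y.
Proof. exact: Quotient.pi_add. Qed.

Lemma pi_surj (q : lquot) : exists x, q = \pi_lquot x.
Proof. by exists (repr q); rewrite reprK. Qed.

Fact lquot_scaleA a b x :
  lquot_scale a (lquot_scale b x) = lquot_scale (a * b) x.
Proof.
by have [y ->] := pi_surj x; rewrite -(pi_scale b) -(pi_scale a) scalerA pi_scale.
Qed.
Fact lquot_scale1 : left_id 1 lquot_scale.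
Proof. by move=> x; have [y ->] := pi_surj x; rewrite -(pi_scale 1) scale1r. Qed.
Fact lquot_scaleDr : right_distributive lquot_scale +%R.
Proof.
move=> a x y; have [x' ->] := pi_surj x; have [y' ->] := pi_surj y.
by rewrite -pi_add -(pi_scale a x') -(pi_scale a y') -(pi_scale a) scalerDr pi_add.
Qed.
Fact lquot_scaleDl x : {morph lquot_scale^~ x : a b / a + b}.
Proof.
move=> a b /=; have [y ->] := pi_surj x.
by rewrite -(pi_scale a) -(pi_scale b) -(pi_scale (a + b)) scalerDl pi_add.
Qed.
HB.instance Definition _ := GRing.Zmodule_isLmodule.Build k lquot
  lquot_scaleA lquot_scale1 lquot_scaleDr lquot_scaleDl.

Fact lproj_linear : linear (fun x : M => \pi_lquot x : lquot).
Proof. by move=> a x y; rewrite pi_add pi_scale. Qed.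
Definition lproj : {linear M -> lquot} := mklin lproj_linear.

Lemma lproj_surj (q : lquot) : exists x, q = lproj x.
Proof. exact: pi_surj. Qed.

Lemma lprojP x y : reflect (lproj x = lproj y) (x - y \in S).
Proof. exact: lquot_eqP. Qed.

Section Lift.
Variables (N : lmodType k) (f : {linear M -> N}).
Hypothesis fS : forall x, x \in S -> f x = 0.
Let g (q : lquot) : N := f (repr q).
Let gE x : g (lproj x) = f x.
Proof.
apply/eqP; rewrite -subr_eq0 -linearB fS //; apply/lquot_eqP.
by rewrite reprK.
Qed.
Fact lquot_lift_linear : linear g.
Proof.
move=> a p q; case: (lproj_surj p) => x ->; case: (lproj_surj q) => y ->.
by rewrite -linearP !gE linearP.
Qed.
Definition lquot_lift : {linear lquot -> N} := mklin lquot_lift_linear.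
Lemma lquot_liftE x : lquot_lift (lproj x) = f x.
Proof. exact: gE. Qed.
End Lift.

End QuotientSpace.

(* Direct sum of an arbitrary family: the dependent functions with finite
   support. Index types carry no decidable equality, hence {classic I}. *)
Section DirectSum.
Variables (k : fieldType) (I : Type) (M : I -> lmodType k).

Definition prodmod : Type := forall i, M i.
HB.instance Definition _ := gen_eqMixin prodmod.
HB.instance Definition _ := gen_choiceMixin prodmod.

Definition prodmod_add (f g : prodmod) : prodmod := fun i => f i + g i.
Definition prodmod_opp (f : prodmod) : prodmod := fun i => - f i.
Definition prodmod_scale a (f : prodmod) : prodmod := fun i => a *: f i.

Fact prodmod_addA : associative prodmod_add.
Proof. by move=> f g h; apply: functional_extensionality_dep => i; exact: addrA. Qed.
Fact prodmod_addC : commutative prodmod_add.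
Proof. by move=> f g; apply: functional_extensionality_dep => i; exact: addrC. Qed.
Fact prodmod_add0 : left_id (fun i => 0 : M i) prodmod_add.
Proof. by move=> f; apply: functional_extensionality_dep => i; exact: add0r. Qed.
Fact prodmod_addN : left_inverse (fun i => 0 : M i) prodmod_opp prodmod_add.
Proof. by move=> f; apply: functional_extensionality_dep => i; exact: addNr. Qed.
HB.instance Definition _ := GRing.isZmodule.Build prodmod
  prodmod_addA prodmod_addC prodmod_add0 prodmod_addN.

Fact prodmod_scaleA a b f : prodmod_scale a (prodmod_scale b f) = prodmod_scale (a * b) f.
Proof. by apply: functional_extensionality_dep => i; exact: scalerA. Qed.
Fact prodmod_scale1 : left_id 1 prodmod_scale.
Proof. by move=> f; apply: functional_extensionality_dep => i; exact: scale1r. Qed.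
Fact prodmod_scaleDr : right_distributive prodmod_scale +%R.
Proof. by move=> a f g; apply: functional_extensionality_dep => i; exact: scalerDr. Qed.
Fact prodmod_scaleDl f : {morph prodmod_scale^~ f : a b / a + b}.
Proof. by move=> a b; apply: functional_extensionality_dep => i; exact: scalerDl. Qed.
HB.instance Definition _ := GRing.Zmodule_isLmodule.Build k prodmod
  prodmod_scaleA prodmod_scale1 prodmod_scaleDr prodmod_scaleDl.

Definition dsupp (f : prodmod) : set {classic I} := [set i | f i != 0].

Definition finsupp_pred : {pred prodmod} := fun f => `[< finite_set (dsupp f) >].

Fact finsupp_closed : GRing.subsemimod_closed finsupp_pred.
Proof.
split; first split.
- apply/asboolP; apply: (@sub_finite_set _ _ set0) => // i.
  by rewrite /dsupp /= eqxx.
- move=> f g /asboolP hf /asboolP hg; apply/asboolP.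
  apply: (@sub_finite_set _ _ (dsupp f `|` dsupp g)); last by rewrite finite_setU.
  move=> i; rewrite /dsupp /= => hi.
  have [ef|] := eqVneq (f i) 0; last by left.
  right; apply: contraNN hi => /eqP eg.
  by apply/eqP; transitivity (f i + g i) => //; rewrite ef eg addr0.
- move=> a f /asboolP hf; apply/asboolP; apply: sub_finite_set hf => i.
  rewrite /dsupp /=; apply: contraNN => /eqP e.
  by apply/eqP; transitivity (a *: f i) => //; rewrite e scaler0.
Qed.
HB.instance Definition _ :=
  GRing.isSubSemiModClosed.Build k prodmod finsupp_pred finsupp_closed.

Definition dsum : lmodType k := submod finsupp_pred.

Definition dcoord (i : I) (f : dsum) : M i := submod_val f i.
Arguments dcoord : simpl never.

Lemma dsum_ext (f g : dsum) : (forall i, dcoord i f = dcoord i g) -> f = g.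
Proof. by move=> h; apply/val_inj; apply: functional_extensionality_dep. Qed.

Fact dcoord_linear i : linear (dcoord i).
Proof. by []. Qed.
HB.instance Definition _ i :=
  GRing.isLinear.Build k dsum (M i) *:%R (dcoord i) (dcoord_linear i).

Definition dinj_fun i (m : M i) : prodmod := fun j =>
  match pselect (i = j) with
  | left e => eq_rect i (fun j => M j : Type) m j e
  | right _ => 0
  end.

Fact dinj_subproof i (m : M i) : dinj_fun m \in finsupp_pred.
Proof.
apply/asboolP; apply: (@sub_finite_set _ _ [set (i : {classic I})]) => // j.
by rewrite /dsupp /= /dinj_fun; case: pselect => [e _|_]; last rewrite eqxx.
Qed.

Definition dinj_val i (m : M i) : dsum := Submod (dinj_subproof m).

Lemma dinj_val_eq i (m : M i) : dcoord i (dinj_val m) = m.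
Proof.
rewrite /dcoord /= /dinj_fun; case: pselect => // e.
by rewrite (Prop_irrelevance e erefl).
Qed.

Lemma dinj_val_neq i j (m : M i) : i <> j -> dcoord j (dinj_val m) = 0.
Proof. by rewrite /dcoord /= /dinj_fun; case: pselect. Qed.

Fact dinj_linear i : linear (@dinj_val i).
Proof.
move=> a m n; apply: dsum_ext => j; rewrite linearP /=.
have [e|ne] := pselect (i = j); first by case: _ / e; rewrite !dinj_val_eq.
by rewrite !dinj_val_neq // scaler0 addr0.
Qed.
Definition dinj i : {linear M i -> dsum} := mklin (@dinj_linear i).

Lemma dcoord_dinj i (m : M i) : dcoord i (dinj i m) = m.
Proof. exact: dinj_val_eq. Qed.

Lemma dcoord_dinj_neq i j (m : M i) : i <> j -> dcoord j (dinj i m) = 0.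
Proof. exact: dinj_val_neq. Qed.

Definition dsum_support (f : dsum) : seq {classic I} :=
  fset_set (dsupp (submod_val f)).

Lemma mem_dsum_support (f : dsum) (i : I) :
  (i : {classic I}) \in dsum_support f = (dcoord i f != 0).
Proof.
rewrite in_fset_set; last exact/asboolP/(submod_valP f).
by apply/asboolP/idP.
Qed.

Lemma uniq_dsum_support (f : dsum) : uniq (dsum_support f).
Proof. exact: fset_uniq. Qed.

Lemma dsumE (f : dsum) : f = \sum_(i <- dsum_support f) dinj i (dcoord i f).
Proof.
apply: dsum_ext => j; rewrite linear_sum /=.
have [hj|hj] := boolP ((j : {classic I}) \in dsum_support f).
  rewrite (bigD1_seq (j : {classic I})) ?uniq_dsum_support //=.
  rewrite dinj_val_eq big1 ?addr0 // => i /eqP ne.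
  exact: dinj_val_neq.
rewrite big1_seq => [|i /andP[_ hi]]; last first.
  by apply: dinj_val_neq => e; move: hj; rewrite -e hi.
by move: hj; rewrite mem_dsum_support negbK => /eqP.
Qed.

Lemma dsum_ind (P : dsum -> Prop) : P 0 -> (forall f g, P f -> P g -> P (f + g)) ->
  (forall i m, P (dinj i m)) -> forall f, P f.
Proof. by move=> P0 PD Pi f; rewrite (dsumE f); apply: big_ind => // i _. Qed.

Lemma dsum_linear_ext (N : lmodType k) (f g : {linear dsum -> N}) :
  (forall i m, f (dinj i m) = g (dinj i m)) -> f =1 g.
Proof.
move=> h; apply: dsum_ind => [|x y ex ey|//]; first by rewrite !linear0.
by rewrite !linearD ex ey.
Qed.

Section Lift.
Variables (N : lmodType k) (phi : forall i, {linear M i -> N}).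

Definition dsum_lift_val (f : dsum) : N :=
  \sum_(i <- dsum_support f) phi i (dcoord i f).

Lemma dsum_lift_seq (f : dsum) (s : seq {classic I}) : uniq s ->
    (forall i : I, dcoord i f != 0 -> (i : {classic I}) \in s) ->
  dsum_lift_val f = \sum_(i <- s) phi i (dcoord i f).
Proof.
move=> us hs; rewrite /dsum_lift_val.
rewrite [RHS](bigID (fun i => dcoord i f != 0)) /= [X in _ + X]big1 ?addr0; last first.
  by move=> i; rewrite negbK => /eqP ->; rewrite linear0.
rewrite -[RHS]big_filter; apply: perm_big; apply: uniq_perm.
- exact: uniq_dsum_support.
- exact: filter_uniq.
move=> i; rewrite mem_filter mem_dsum_support.
by have [/hs ->|] := boolP (dcoord i f != 0).
Qed.

Fact dsum_lift_linear : linear dsum_lift_val.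
Proof.
move=> a f g.
pose s := undup (dsum_support f ++ dsum_support g).
have us : uniq s := undup_uniq _.
have hf i : dcoord i f != 0 -> (i : {classic I}) \in s.
  by rewrite mem_undup mem_cat !mem_dsum_support => ->.
have hg i : dcoord i g != 0 -> (i : {classic I}) \in s.
  by rewrite mem_undup mem_cat !mem_dsum_support => ->; rewrite orbT.
rewrite (dsum_lift_seq us hf) (dsum_lift_seq us hg) (@dsum_lift_seq _ s us).
  rewrite scaler_sumr -big_split /=; apply: eq_bigr => i _.
  by rewrite !linearP.
move=> i; rewrite linearP /=; have [ef|/hf //] := eqVneq (dcoord i f) 0.
by rewrite ef scaler0 add0r => /hg.
Qed.
Definition dsum_lift : {linear dsum -> N} := mklin dsum_lift_linear.

Lemma dsum_lift_dinj i m : dsum_lift (dinj i m) = phi i m.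
Proof.
rewrite /= (@dsum_lift_seq _ [:: (i : {classic I})]) //; last first.
  move=> j; rewrite inE; have [//|ne] := eqVneq (j : {classic I}) i.
  by rewrite dinj_val_neq ?eqxx // => e; rewrite e eqxx in ne.
by rewrite big_seq1 dinj_val_eq.
Qed.
End Lift.

End DirectSum.

(* [hom x y] is the space of morphisms from x to y, written _yC_x in the
   mathematical notation; likewise a family V x y below stands for _yV_x. *)
Record kcat (k : fieldType) := Kcat {
  ob :> Type;
  hom : ob -> ob -> lmodType k;
  kid : forall x, hom x x;
  kcomp : forall x y z, hom y z -> hom x y -> hom x z;
  kcomp_linl : forall x y z (f : hom x y),
    linear (fun g : hom y z => kcomp g f);
  kcomp_linr : forall x y z (g : hom y z),
    linear (fun f : hom x y => kcomp g f);
  kcompA : forall x y z t (h : hom z t) (g : hom y z) (f : hom x y),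
    kcomp h (kcomp g f) = kcomp (kcomp h g) f;
  kcomp1l : forall x y (f : hom x y), kcomp (kid y) f = f;
  kcomp1r : forall x y (f : hom x y), kcomp f (kid x) = f
}.
Arguments kid {k} _ _.
Arguments kcomp {k} _ {x y z} _ _.

Record kfunctor (k : fieldType) (C D : kcat k) := Kfunctor {
  fob :> C -> D;
  fmap : forall x y, hom x y -> hom (fob x) (fob y);
  fmap_lin : forall x y, linear (@fmap x y);
  fmap1 : forall x, fmap (kid C x) = kid D (fob x);
  fmapM : forall x y z (g : hom y z) (f : hom x y),
    fmap (kcomp C g f) = kcomp D (fmap g) (fmap f)
}.
Arguments fmap {k C D} _ {x y} _.

Section Functors.
Variable k : fieldType.

Definition kfunctor_id (C : kcat k) : kfunctor C C :=
  @Kfunctor k C C id (fun _ _ => id) (fun _ _ _ _ _ => erefl)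
    (fun _ => erefl) (fun _ _ _ _ _ => erefl).

Section Comp.
Variables (C D E : kcat k) (G : kfunctor D E) (F : kfunctor C D).
Let gf x y (f : hom x y) := fmap G (fmap F f).
Fact kfunctor_comp_lin x y : linear (@gf x y).
Proof. by move=> a f g; rewrite /gf !fmap_lin. Qed.
Fact kfunctor_comp1 x : gf (kid C x) = kid E (G (F x)).
Proof. by rewrite /gf !fmap1. Qed.
Fact kfunctor_compM x y z (g : hom y z) (f : hom x y) :
  gf (kcomp C g f) = kcomp E (gf g) (gf f).
Proof. by rewrite /gf !fmapM. Qed.
Definition kfunctor_comp : kfunctor C E :=
  @Kfunctor k C E (fun x => G (F x)) gf
    kfunctor_comp_lin kfunctor_comp1 kfunctor_compM.
End Comp.

Lemma kfunctor_ext (C D : kcat k) (fo : C -> D)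
    (m m' : forall x y, hom x y -> hom (fo x) (fo y)) l i c l' i' c' :
    (forall x y (f : hom x y), m x y f = m' x y f) ->
  @Kfunctor k C D fo m l i c = @Kfunctor k C D fo m' l' i' c'.
Proof.
move=> e; have em : m = m'.
  by do 3 (apply: functional_extensionality_dep => ?); exact: e.
by case: _ / em l' i' c' => l' i' c'; congr Kfunctor; exact: Prop_irrelevance.
Qed.

(* Leibniz equality of functors is the intended one: functional extensionality
   and proof irrelevance make it equality on objects and on morphisms. *)
Definition isomorphism (C D : kcat k) (F : kfunctor C D) : Prop :=
  exists G : kfunctor D C,
    kfunctor_comp G F = kfunctor_id C /\ kfunctor_comp F G = kfunctor_id D.

End Functors.

Section Sequences.
Variable L0 : Type.

(* [oseq x y]: the sequences (y = u_n, ..., u_0 = x) of elements of L0; any two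
   consecutive elements are allowed. [ocons z u] puts z in front of u, so that
   [ocat v u] is vu, with the last term of u and the first of v identified. *)
Inductive oseq (x : L0) : L0 -> Type :=
| onil : oseq x x
| ocons y z : oseq x y -> oseq x z.

Fixpoint olength x y (u : oseq x y) : nat :=
  if u is ocons _ _ u' then (olength u').+1 else 0%N.

Fixpoint ocat x y z (v : oseq y z) : oseq x y -> oseq x z :=
  match v in oseq _ z return oseq x y -> oseq x z with
  | onil => id
  | ocons _ z v' => fun u => ocons z (ocat v' u)
  end.

Fixpoint all_steps (P : L0 -> L0 -> Prop) x y (u : oseq x y) : Prop :=
  if u is ocons y z u' then P y z /\ all_steps P u' else True.

Lemma ocatA x y z t (w : oseq z t) (v : oseq y z) (u : oseq x y) :
  ocat w (ocat v u) = ocat (ocat w v) u.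
Proof. by elim: w => //= a b w ->. Qed.

Lemma ocat_onil x y (u : oseq x y) : ocat u (onil x) = u.
Proof. by elim: u => //= a b u ->. Qed.

End Sequences.
Arguments onil {L0 x}.

Section Tensor.
Variables (k : fieldType) (L0 : Type) (V : L0 -> L0 -> lmodType k).

Fixpoint factors x y (u : oseq x y) : Type :=
  if u is ocons y z u' then (V y z * factors u')%type else unit.

Fixpoint multilinear x y (u : oseq x y) (N : lmodType k) :
    (factors u -> N) -> Prop :=
  match u return (factors u -> N) -> Prop with
  | onil => fun _ => True
  | ocons y z u' => fun f : V y z * factors u' -> N =>
      (forall q, linear (fun v => f (v, q))) /\
      (forall v, multilinear (fun q => f (v, q)))
  end.

(* The elements that must vanish for e to be multilinear. *)
Fixpoint multilinear_relations x y (u : oseq x y) (N : lmodType k) :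
    (factors u -> N) -> set N :=
  match u return (factors u -> N) -> set N with
  | onil => fun _ => set0
  | ocons y z u' => fun e : V y z * factors u' -> N =>
      [set m | (exists a v w q,
                  m = e (a *: v + w, q) - (a *: e (v, q) + e (w, q)))
            \/ (exists v, multilinear_relations (fun q => e (v, q)) m)]
  end.

Definition free_module (T : Type) : lmodType k := dsum (fun _ : T => k^o).
Definition free_basis (T : Type) (t : T) : free_module T :=
  dinj (fun _ : T => k^o) t 1.

(* W(u), the n-fold tensor product of the spaces along u: the free module on
   tuples of factors modulo multilinearity. For the singleton sequence there is
   one (empty) tuple and no relation, which gives k. *)
Definition tensor x y (u : oseq x y) : lmodType k :=
  lquot (lspan (multilinear_relations (@free_basis (factors u)))).

Definition pure x y (u : oseq x y) (p : factors u) : tensor u :=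
  lproj (lspan (multilinear_relations (@free_basis (factors u)))) (free_basis p).

Lemma multilinear_relationsP x y (u : oseq x y) (M N : lmodType k)
    (e : factors u -> M) (g : {linear M -> N}) :
  (forall m, multilinear_relations e m -> g m = 0) <->
  multilinear (fun p => g (e p)).
Proof.
elim: u e => [|a b u IH] //= e; split.
  move=> h; split=> [q c v w|v].
    apply/eqP; rewrite -subr_eq0 -linearP -linearB; apply/eqP/h; left.
    by exists c, v, w, q.
  by apply/IH => m hm; apply: h; right; exists v.
move=> [h1 h2] m [[c [v [w [q ->]]]]|[v hm]].
  by rewrite linearB linearP h1 subrr.
by have /IH := h2 v; apply.
Qed.

Lemma pure_multilinear x y (u : oseq x y) : multilinear (@pure _ _ u).
Proof.
apply/multilinear_relationsP => m hm; apply/eqP.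
rewrite -(linear0 (lproj _)); apply/eqP/lprojP.
by rewrite subr0; apply: mem_lspan.
Qed.

Section Lift.
Variables (x y : L0) (u : oseq x y) (N : lmodType k) (f : factors u -> N).
Hypothesis fml : multilinear f.

Fact scale_on_linear (n : N) : linear (fun a : k^o => a *: n).
Proof. by move=> a b c; rewrite scalerDl scalerA. Qed.

Definition free_module_lift : {linear free_module (factors u) -> N} :=
  dsum_lift (fun p => mklin (scale_on_linear (f p))).

Lemma free_module_liftE p : free_module_lift (free_basis p) = f p.
Proof. by rewrite dsum_lift_dinj /= scale1r. Qed.

Fact free_module_lift_relations m :
  m \in lspan (multilinear_relations (@free_basis (factors u))) ->
  free_module_lift m = 0.
Proof.
move=> hm; apply/eqP; apply: (@lspan_min _ _ _ (lin_ker free_module_lift) m _ hm) => n hn.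
apply/eqP; move: n hn; apply/multilinear_relationsP.
by rewrite (_ : (fun p => _) = f) //; apply/funext => p; rewrite free_module_liftE.
Qed.

Definition tensor_lift : {linear tensor u -> N} :=
  lquot_lift free_module_lift_relations.

Lemma tensor_liftE p : tensor_lift (pure p) = f p.
Proof. by rewrite [LHS]lquot_liftE free_module_liftE. Qed.
End Lift.

Lemma tensor_ind x y (u : oseq x y) (P : tensor u -> Prop) :
    P 0 -> (forall a b, P a -> P b -> P (a + b)) ->
    (forall c a, P a -> P (c *: a)) -> (forall p, P (pure p)) ->
  forall a, P a.
Proof.
move=> P0 PD PZ Pp a; have [m ->] := lproj_surj a.
elim/dsum_ind: m => [|m n hm hn|p c]; first by rewrite linear0.
  by rewrite linearD; exact: PD.
have -> : dinj (fun=> k^o) p c = c *: free_basis p.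
  by rewrite /free_basis -linearZ /= [_ *: _]mulr1.
by rewrite linearZ; exact: PZ (Pp p).
Qed.

Lemma tensor_linear_ext x y (u : oseq x y) (N : lmodType k)
    (f g : {linear tensor u -> N}) :
  (forall p, f (pure p) = g (pure p)) -> f =1 g.
Proof.
move=> h; apply: tensor_ind => [|a b ea eb|c a ea|//].
- by rewrite !linear0.
- by rewrite !linearD ea eb.
- by rewrite !linearZ ea.
Qed.

Lemma multilinear0 x y (u : oseq x y) (N : lmodType k) :
  multilinear (fun _ : factors u => 0 : N).
Proof. by elim: u => //= a b u IH; split=> // q c v w; rewrite scaler0 addr0. Qed.

Lemma multilinearP x y (u : oseq x y) (N : lmodType k) c (f g : factors u -> N) :
  multilinear f -> multilinear g -> multilinear (fun p => c *: f p + g p).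
Proof.
elim: u f g => //= a b u IH f g [f1 f2] [g1 g2]; split=> [q d v w|v].
  rewrite f1 g1 !scalerDr !scalerA [d * c]mulrC -!addrA; congr (_ + _).
  by rewrite addrCA.
exact: IH.
Qed.

Lemma multilinear_linear x y (u : oseq x y) (M N : lmodType k)
    (g : {linear M -> N}) (f : factors u -> M) :
  multilinear f -> multilinear (fun p => g (f p)).
Proof.
elim: u f => //= a b u IH f [f1 f2]; split=> [q c v w|v]; last exact: IH.
by rewrite f1 linearP.
Qed.

Fixpoint fcat x y z (v : oseq y z) (u : oseq x y) :
    factors v -> factors u -> factors (ocat v u) :=
  match v return factors v -> factors u -> factors (ocat v u) with
  | onil => fun _ q => q
  | ocons _ _ v' => fun p q => (p.1, fcat p.2 q)
  end.

Lemma multilinear_fcatl x y z (v : oseq y z) (u : oseq x y) (N : lmodType k)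
    (f : factors (ocat v u) -> N) (q : factors u) :
  multilinear f -> multilinear (fun p => f (fcat p q)).
Proof. by elim: v f => //= a b v IH f [f1 f2]; split=> // w; exact: (IH (fun r => f (w, r))). Qed.

Lemma multilinear_fcatr x y z (v : oseq y z) (u : oseq x y) (N : lmodType k)
    (f : factors (ocat v u) -> N) (p : factors v) :
  multilinear f -> multilinear (fun q => f (fcat p q)).
Proof. by elim: v f p => //= a b v IH f [w p] [f1 f2]; exact: (IH (fun r => f (w, r))). Qed.

Section Tmul.
Variables (x y z : L0) (v : oseq y z) (u : oseq x y).

Definition tmul_factors (q : factors u) : {linear tensor v -> tensor (ocat v u)} :=
  tensor_lift (multilinear_fcatl q (@pure_multilinear _ _ (ocat v u))).

Fact tmul_factors_multilinear (a : tensor v) :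
  multilinear (fun q => tmul_factors q a).
Proof.
elim/tensor_ind: a => [|a b ha hb|c a ha|p].
- rewrite (_ : (fun q => _) = (fun=> 0)); first exact: multilinear0.
  by apply/funext => q; rewrite linear0.
- have := multilinearP 1 ha hb; congr multilinear; apply/funext => q.
  by rewrite scale1r linearD.
- have := multilinearP c ha (@multilinear0 _ _ u _); congr multilinear.
  by apply/funext => q; rewrite addr0 linearZ.
rewrite (_ : (fun q => _) = (fun q => pure (fcat p q))).
  by apply: multilinear_fcatr; exact: pure_multilinear.
by apply/funext => q; rewrite tensor_liftE.
Qed.

Definition tmul (a : tensor v) (b : tensor u) : tensor (ocat v u) :=
  tensor_lift (tmul_factors_multilinear a) b.

Lemma tmul_pure p q : tmul (pure p) (pure q) = pure (fcat p q).
Proof. by rewrite /tmul !tensor_liftE. Qed.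

Fact tmul_linr a : linear (tmul a).
Proof. by move=> c b b'; rewrite /tmul linearP. Qed.

Fact tmul_linl b : linear (tmul^~ b).
Proof.
move=> c a a' /=; elim/tensor_ind: b => [|b b' hb hb'|d b hb|q].
- by rewrite /tmul !linear0 addr0.
- rewrite -[b]scale1r !tmul_linr !scale1r hb hb' !scalerDr -!addrA.
  by congr (_ + _); rewrite addrCA.
- have E e : tmul e (d *: b) = d *: tmul e b by rewrite /tmul linearZ.
  by rewrite !E hb scalerDr !scalerA mulrC.
- by rewrite /tmul !tensor_liftE linearP.
Qed.
End Tmul.

End Tensor.

Section FreeCategory.
Variables (k : fieldType) (L0 : Type) (V : L0 -> L0 -> lmodType k).

Definition free_hom (x y : L0) : lmodType k := dsum (fun u : oseq x y => tensor V u).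

Definition free_inj x y (u : oseq x y) : {linear tensor V u -> free_hom x y} :=
  dinj (fun u : oseq x y => tensor V u) u.

Definition free_mono x y (u : oseq x y) (p : factors V u) : free_hom x y :=
  free_inj u (pure p).

Lemma free_hom_ind x y (P : free_hom x y -> Prop) :
    P 0 -> (forall a b, P a -> P b -> P (a + b)) ->
    (forall c a, P a -> P (c *: a)) -> (forall u p, P (@free_mono x y u p)) ->
  forall a, P a.
Proof.
move=> P0 PD PZ Pp; apply: dsum_ind => // u.
elim/tensor_ind => [|a b ha hb|c a ha|p]; last exact: Pp.
- by rewrite linear0.
- by rewrite linearD; exact: PD.
- by rewrite linearZ; exact: PZ.
Qed.

Lemma free_hom_ext x y (N : lmodType k) (f g : free_hom x y -> N) :
  linear f -> linear g -> (forall u p, f (@free_mono x y u p) = g (free_mono p)) ->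
  f =1 g.
Proof.
move=> lf lg; pose f' := mklin lf; pose g' := mklin lg.
change ((forall u p, f' (@free_mono x y u p) = g' (free_mono p)) -> f' =1 g').
move=> h; apply: free_hom_ind => [|a b ea eb|c a ea|//].
- by rewrite !linear0.
- by rewrite !linearD ea eb.
- by rewrite !linearZ ea.
Qed.

Section Composition.
Variables x y z : L0.

Fact free_comp1_linear (u : oseq x y) (b : tensor V u) (v : oseq y z) :
  linear (fun a : tensor V v => free_inj (ocat v u) (tmul a b)).
Proof. by move=> c a a'; rewrite tmul_linl linearP. Qed.

Definition free_comp1 (u : oseq x y) (b : tensor V u) :
    {linear free_hom y z -> free_hom x z} :=
  dsum_lift (fun v => mklin (@free_comp1_linear u b v)).

Fact free_comp1_linr (g : free_hom y z) (u : oseq x y) :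
  linear (fun b : tensor V u => free_comp1 b g).
Proof.
move=> c b b'; elim/dsum_ind: g => [|g h hg hh|v a].
- by rewrite !linear0 addr0.
- by rewrite !linearD hg hh -!addrA; congr (_ + _); rewrite addrCA.
- by rewrite !dsum_lift_dinj !mklinE tmul_linr; exact: dinj_linear.
Qed.

Definition free_comp (g : free_hom y z) (f : free_hom x y) : free_hom x z :=
  dsum_lift (fun u => mklin (@free_comp1_linr g u)) f.

Lemma free_comp_inj (v : oseq y z) (u : oseq x y) a b :
  free_comp (free_inj v a) (free_inj u b) = free_inj (ocat v u) (tmul a b).
Proof. by rewrite /free_comp dsum_lift_dinj /= [LHS]dsum_lift_dinj. Qed.

Lemma free_comp_mono (v : oseq y z) (u : oseq x y) p q :
  free_comp (free_mono p) (free_mono q) = @free_mono _ _ (ocat v u) (fcat p q).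
Proof. by rewrite free_comp_inj tmul_pure. Qed.

Fact free_comp_linr g : linear (free_comp g).
Proof. by move=> c f f'; rewrite /free_comp linearP. Qed.

Fact free_comp_linl f : linear (free_comp^~ f).
Proof.
move=> c g g' /=; rewrite /free_comp; elim/dsum_ind: f => [|f h hf hh|u b].
- by rewrite !linear0 addr0.
- by rewrite !linearD hf hh -!addrA; congr (_ + _); rewrite addrCA.
- by rewrite !dsum_lift_dinj; exact: (linearP (free_comp1 b)).
Qed.
End Composition.

Definition free_id x : free_hom x x := @free_mono x x onil tt.

Fact free_mono_eq x y (u u' : oseq x y) (e : u = u') p :
  @free_mono x y u p = @free_mono x y u' (eq_rect u (@factors _ _ V x y) p u' e).
Proof. by case: _ / e. Qed.

Lemma eq_rect_ocons x y z (u u' : oseq x y) (e : u = u') (w : V y z)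
    (p : factors V u) (e' : ocons z u = ocons z u') :
  eq_rect (ocons z u) (@factors _ _ V x z) (w, p) (ocons z u') e' =
  (w, eq_rect u (@factors _ _ V x y) p u' e).
Proof. by case: _ / e e' => e'; rewrite (Prop_irrelevance e' erefl). Qed.

Lemma fcatA x y z t (w : oseq z t) (v : oseq y z) (u : oseq x y) p q r
    (e : ocat w (ocat v u) = ocat (ocat w v) u) :
  eq_rect _ (@factors _ _ V x t) (@fcat _ _ V _ _ _ w _ p (fcat q r)) _ e =
  @fcat _ _ V _ _ _ (ocat w v) u (fcat p q) r.
Proof.
elim: w p e => /= [p e|a b w IH [h p] e]; first by rewrite (Prop_irrelevance e erefl).
by rewrite (eq_rect_ocons (ocatA w v u)) IH.
Qed.

Lemma fcat_tt x y (u : oseq x y) p (e : ocat u onil = u) :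
  eq_rect _ (@factors _ _ V x y) (@fcat _ _ V _ _ _ u onil p tt) _ e = p.
Proof.
elim: u p e => /= [[] e|a b u IH [h p] e]; first by rewrite (Prop_irrelevance e erefl).
by rewrite (eq_rect_ocons (ocat_onil u)) IH.
Qed.

Fact free_compA x y z t (h : free_hom z t) (g : free_hom y z) (f : free_hom x y) :
  free_comp h (free_comp g f) = free_comp (free_comp h g) f.
Proof.
move: f; apply: free_hom_ext => [c f f'|c f f'|u r].
- by rewrite !free_comp_linr.
- by rewrite free_comp_linr.
move: g; apply: free_hom_ext => [c f f'|c f f'|v q].
- by rewrite free_comp_linl free_comp_linr.
- by rewrite free_comp_linr free_comp_linl.
move: h; apply: free_hom_ext => [c f f'|c f f'|w p].
- by rewrite free_comp_linl.
- by rewrite !free_comp_linl.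
by rewrite !free_comp_mono (free_mono_eq (ocatA w v u)) fcatA.
Qed.

Fact free_comp1l x y (f : free_hom x y) : free_comp (free_id y) f = f.
Proof.
move: f; apply: free_hom_ext => [||u q] //; first exact: free_comp_linr.
by rewrite free_comp_mono.
Qed.

Fact free_comp1r x y (f : free_hom x y) : free_comp f (free_id x) = f.
Proof.
move: f; apply: free_hom_ext => [||u q] //; first exact: free_comp_linl.
by rewrite free_comp_mono (free_mono_eq (ocat_onil u)) fcat_tt.
Qed.

Definition free_kcat : kcat k :=
  @Kcat k L0 free_hom free_id free_comp
    free_comp_linl free_comp_linr free_compA free_comp1l free_comp1r.

Definition free_gen x y (v : V x y) : free_hom x y :=
  @free_mono x y (ocons y onil) (v, tt).

Fact free_gen_linear x y : linear (@free_gen x y).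
Proof.
move=> a v w; rewrite /free_gen /free_mono.
have [pl _] := @pure_multilinear k L0 V x y (ocons y onil).
by rewrite [pure _]pl linearP.
Qed.

Section UniversalProperty.
Variables (B : kcat k) (F0 : L0 -> B).
Variable phi : forall x y, {linear V x y -> hom (F0 x) (F0 y)}.

Fixpoint eval_factors x y (u : oseq x y) : factors V u -> hom (F0 x) (F0 y) :=
  match u in oseq _ y return factors V u -> hom (F0 x) (F0 y) with
  | onil => fun _ => kid B (F0 x)
  | ocons y z u' => fun p => kcomp B (phi y z p.1) (eval_factors p.2)
  end.

Fact eval_factors_multilinear x y (u : oseq x y) : multilinear (@eval_factors x y u).
Proof.
elim: u => //= a b u IH; split=> [q c v w|v].
  by rewrite linearP kcomp_linl.
by have := multilinear_linear (mklin (kcomp_linr (phi a b v))) IH.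
Qed.

Lemma eval_factors_fcat x y z (v : oseq y z) (u : oseq x y) p q :
  @eval_factors x z (ocat v u) (fcat p q) =
  kcomp B (@eval_factors y z v p) (@eval_factors x y u q).
Proof.
elim: v p => [p|a b v IH [w p]] /=; first by rewrite kcomp1l.
by rewrite IH kcompA.
Qed.

Definition free_functor_map x y : {linear free_hom x y -> hom (F0 x) (F0 y)} :=
  dsum_lift (fun u => tensor_lift (@eval_factors_multilinear x y u)).

Lemma free_functor_map_mono x y u p :
  free_functor_map x y (@free_mono x y u p) = eval_factors p.
Proof. by rewrite /free_functor_map dsum_lift_dinj tensor_liftE. Qed.

Fact free_functor_map_lin x y : linear (free_functor_map x y).
Proof. exact: linearP. Qed.

Fact free_functor_map1 x : free_functor_map x x (free_id x) = kid B (F0 x).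
Proof. by rewrite free_functor_map_mono. Qed.

Fact free_functor_mapM x y z (g : free_hom y z) (f : free_hom x y) :
  free_functor_map x z (free_comp g f) =
  kcomp B (free_functor_map y z g) (free_functor_map x y f).
Proof.
move: f; apply: free_hom_ext => [c f f'|c f f'|u q].
- by rewrite free_comp_linr linearP.
- by rewrite linearP kcomp_linr.
move: g; apply: free_hom_ext => [c f f'|c f f'|v p].
- by rewrite free_comp_linl linearP.
- by rewrite linearP kcomp_linl.
by rewrite free_comp_mono !free_functor_map_mono eval_factors_fcat.
Qed.

Definition free_functor : kfunctor free_kcat B :=
  @Kfunctor k free_kcat B F0 (fun x y => free_functor_map x y)
    free_functor_map_lin free_functor_map1 free_functor_mapM.

Lemma free_functor_gen x y (v : V x y) : fmap free_functor (free_gen v) = phi x y v.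
Proof. by rewrite [LHS]free_functor_map_mono /= kcomp1r. Qed.

Lemma free_functor_unique
    (m : forall x y, free_hom x y -> hom (F0 x) (F0 y)) l i c :
    (forall x y v, m x y (free_gen v) = phi x y v) ->
  @Kfunctor k free_kcat B F0 m l i c = free_functor.
Proof.
move=> h; apply: kfunctor_ext => x y f; move: x y f.
move=> x y; apply: free_hom_ext => [||u p]; [exact: l|exact: linearP|].
rewrite free_functor_map_mono; elim: u p => [|y' z u IH] p /=.
  by case: p; exact: i.
case: p => w p; have -> : free_mono ((w, p) : factors V (ocons z u)) =
    free_comp (free_gen w) (free_mono p) by rewrite free_comp_mono.
by rewrite [LHS]c IH h.
Qed.
End UniversalProperty.

End FreeCategory.

(* A left kG-module structure on M, for the finite group G of all elements of
   gT. *)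
Record linear_action (gT : finGroupType) (k : fieldType) (M : lmodType k) :=
  LinearAction {
    act :> gT -> M -> M;
    act_linear : forall g, linear (act g);
    act1 : forall v, act 1%g v = v;
    actM : forall g h v, act (g * h)%g v = act g (act h v)
  }.

Section Invariants.
Variables (gT : finGroupType) (k : fieldType) (M : lmodType k).
Variable rho : linear_action gT M.

Definition invariants : {pred M} := fun v => `[< forall g, rho g v = v >].

Lemma invariantsP v : reflect (forall g, rho g v = v) (v \in invariants).
Proof. exact: asboolP. Qed.

Fact invariants_closed : GRing.subsemimod_closed invariants.
Proof.
have E g a v w : rho g (a *: v + w) = a *: rho g v + rho g w.
  exact: act_linear.
have E0 g : rho g 0 = 0 := linear0 (mklin (act_linear rho g)).
split; first split.
- by apply/invariantsP.
- move=> v w /invariantsP hv /invariantsP hw; apply/invariantsP => g.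
  by have := E g 1 v w; rewrite !scale1r hv hw.
- move=> a v /invariantsP hv; apply/invariantsP => g.
  by have := E g a v 0; rewrite E0 !addr0 hv.
Qed.
HB.instance Definition _ :=
  GRing.isSubSemiModClosed.Build k M invariants invariants_closed.

End Invariants.

(* An action of G by k-linear endofunctors that are the identity on objects. *)
Record kcat_action (gT : finGroupType) (k : fieldType) (C : kcat k) := KcatAction {
  cact :> forall x y, linear_action gT (@hom k C x y);
  cact_id : forall g x, cact x x g (kid C x) = kid C x;
  cact_comp : forall g x y z (b : hom y z) (a : hom x y),
    cact x z g (kcomp C b a) = kcomp C (cact y z g b) (cact x y g a)
}.

Section FixedCategory.
Variables (gT : finGroupType) (k : fieldType) (C : kcat k).
Variable rho : kcat_action gT C.

Definition fixed_hom (x y : C) : lmodType k := submod (invariants (rho x y)).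

Fact fixed_id_subproof x : kid C x \in invariants (rho x x).
Proof. by apply/invariantsP => g; exact: cact_id. Qed.
Definition fixed_id x : fixed_hom x x := Submod (fixed_id_subproof x).

Fact fixed_comp_subproof x y z (b : fixed_hom y z) (a : fixed_hom x y) :
  kcomp C (val b) (val a) \in invariants (rho x z).
Proof.
apply/invariantsP => g; rewrite cact_comp.
by rewrite (invariantsP _ _ (valP b)) (invariantsP _ _ (valP a)).
Qed.
Definition fixed_comp x y z (b : fixed_hom y z) (a : fixed_hom x y) :
  fixed_hom x z := Submod (fixed_comp_subproof b a).

Fact fixed_comp_linl x y z (a : fixed_hom x y) :
  linear (fun b : fixed_hom y z => fixed_comp b a).
Proof. by move=> c b b'; apply: val_inj; exact: kcomp_linl. Qed.
Fact fixed_comp_linr x y z (b : fixed_hom y z) :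
  linear (fun a : fixed_hom x y => fixed_comp b a).
Proof. by move=> c a a'; apply: val_inj; exact: kcomp_linr. Qed.
Fact fixed_compA x y z t (h : fixed_hom z t) (g : fixed_hom y z)
    (f : fixed_hom x y) :
  fixed_comp h (fixed_comp g f) = fixed_comp (fixed_comp h g) f.
Proof. by apply: val_inj; exact: kcompA. Qed.
Fact fixed_comp1l x y (f : fixed_hom x y) : fixed_comp (fixed_id y) f = f.
Proof. by apply: val_inj; exact: kcomp1l. Qed.
Fact fixed_comp1r x y (f : fixed_hom x y) : fixed_comp f (fixed_id x) = f.
Proof. by apply: val_inj; exact: kcomp1r. Qed.

Definition fixed_kcat : kcat k :=
  @Kcat k C fixed_hom fixed_id fixed_comp
    fixed_comp_linl fixed_comp_linr fixed_compA fixed_comp1l fixed_comp1r.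

End FixedCategory.

Section HomogeneousAction.
Variables (gT : finGroupType) (k : fieldType) (L0 : Type).
Variable V : L0 -> L0 -> lmodType k.
Variable rho : forall x y, linear_action gT (V x y).

Fixpoint factors_act (g : gT) x y (u : oseq x y) : factors V u -> factors V u :=
  match u return factors V u -> factors V u with
  | onil => id
  | ocons y z u' => fun p => (rho y z g p.1, factors_act g p.2)
  end.

Lemma factors_act1 x y (u : oseq x y) p : factors_act 1%g (u := u) p = p.
Proof. by elim: u p => //= a b u IH [v p]; rewrite act1 IH. Qed.

Lemma factors_actM g h x y (u : oseq x y) p :
  factors_act (g * h)%g (u := u) p = factors_act g (factors_act h p).
Proof. by elim: u p => //= a b u IH [v p]; rewrite actM IH. Qed.

Lemma factors_act_fcat g x y z (v : oseq y z) (u : oseq x y)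
    (p : factors V v) (q : factors V u) :
  factors_act g (fcat p q) = fcat (factors_act g p) (factors_act g q).
Proof. by elim: v p => //= s t v IH [w p]; rewrite IH. Qed.

Fact factors_act_multilinear g x y (u : oseq x y) (N : lmodType k)
    (f : factors V u -> N) :
  multilinear f -> multilinear (fun p => f (factors_act g p)).
Proof.
elim: u f => //= a b u IH f [f1 f2]; split=> [q c v w|v].
  by rewrite act_linear f1.
exact: (IH (fun q => f (rho a b g v, q))).
Qed.

Definition tensor_act g x y (u : oseq x y) : {linear tensor V u -> tensor V u} :=
  tensor_lift (factors_act_multilinear g (@pure_multilinear k L0 V x y u)).

Lemma tensor_act_pure g x y (u : oseq x y) (p : factors V u) :
  tensor_act g u (pure p) = pure (factors_act g p).
Proof. exact: tensor_liftE. Qed.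

Fact tensor_act_linear x y (u : oseq x y) g : linear (tensor_act g u).
Proof. exact: linearP. Qed.

Fact tensor_act1 x y (u : oseq x y) v : tensor_act 1%g u v = v.
Proof.
move: v; apply: (@tensor_linear_ext _ _ _ _ _ _ _ _ idfun)  => p.
by rewrite tensor_act_pure factors_act1.
Qed.

Fact tensor_actM x y (u : oseq x y) g h v :
  tensor_act (g * h)%g u v = tensor_act g u (tensor_act h u v).
Proof.
move: v; apply: (@tensor_linear_ext _ _ _ _ _ _ _ _ (tensor_act g u \o tensor_act h u)).
by move=> p; rewrite tensor_act_pure factors_actM -!tensor_act_pure.
Qed.

Definition tensor_action x y (u : oseq x y) : linear_action gT (tensor V u) :=
  LinearAction (@tensor_act_linear x y u) (@tensor_act1 x y u) (@tensor_actM x y u).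

Definition free_act g x y : {linear free_hom V x y -> free_hom V x y} :=
  dsum_lift (fun u => free_inj V u \o tensor_act g u).

Lemma free_act_inj g x y (u : oseq x y) a :
  free_act g x y (free_inj V u a) = free_inj V u (tensor_act g u a).
Proof. by rewrite /free_act dsum_lift_dinj. Qed.

Fact free_act_linear x y g : linear (free_act g x y).
Proof. exact: linearP. Qed.

Fact free_act1 x y a : free_act 1%g x y a = a.
Proof.
move: a; apply: free_hom_ext => [||u p] //; first exact: linearP.
by rewrite free_act_inj tensor_act1.
Qed.

Fact free_actM x y g h a :
  free_act (g * h)%g x y a = free_act g x y (free_act h x y a).
Proof.
move: a; apply: free_hom_ext => [|c a b|u p]; first exact: linearP.
  by rewrite !linearP.
by rewrite !free_act_inj tensor_actM.
Qed.

Definition free_linear_action x y : linear_action gT (free_hom V x y) :=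
  LinearAction (free_act_linear (x := x) (y := y))
    (@free_act1 x y) (@free_actM x y).

Fact free_act_id g x : free_act g x x (free_id V x) = free_id V x.
Proof. by rewrite free_act_inj tensor_act_pure. Qed.

Fact free_act_comp g x y z (b : free_hom V y z) (a : free_hom V x y) :
  free_act g x z (free_comp b a) = free_comp (free_act g y z b) (free_act g x y a).
Proof.
move: a; apply: free_hom_ext => [c a a'|c a a'|u q].
- by rewrite free_comp_linr linearP.
- by rewrite linearP free_comp_linr.
move: b; apply: free_hom_ext => [c b b'|c b b'|v p].
- by rewrite free_comp_linl linearP.
- by rewrite linearP free_comp_linl.
by rewrite free_comp_mono !free_act_inj !tensor_act_pure factors_act_fcat free_comp_mono.
Qed.

Definition homogeneous_action : kcat_action gT (free_kcat V) :=
  @KcatAction gT k (free_kcat V) free_linear_action free_act_id free_act_comp.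

Definition free_fixed_kcat : kcat k := fixed_kcat homogeneous_action.

(* The track-quiver has at most one arrow between two vertices, so its oriented
   paths are the sequences of vertices with an arrow at each step. *)
Definition track_arrow (x y : L0) : Prop := exists v : V x y, v != 0.

Record track_path (x y : L0) := TrackPath {
  track_seq :> oseq x y;
  track_pos : (0 < olength track_seq)%N;
  track_arrows : all_steps track_arrow track_seq
}.

(* The vectors a (x) b with a, b invariant, over the decompositions of u into two
   sequences of positive length; their span is the sum of the images of the
   canonical maps. *)
Inductive composite_product (x : L0) : forall y (u : oseq x y), tensor V u -> Prop :=
  CompositeProduct y z (w : oseq y z) (u : oseq x y)
    (a : tensor V w) (b : tensor V u) :
    (0 < olength w)%N -> (0 < olength u)%N ->
    a \in invariants (tensor_action w) -> b \in invariants (tensor_action u) ->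
    composite_product (tmul a b).

Definition composite_invariants x y (u : oseq x y) : {pred tensor V u} :=
  lspan (@composite_product x y u).

Definition irreducible_choice
    (irr : forall x y (c : track_path x y), submodClosed (tensor V c)) : Prop :=
  forall x y (c : track_path x y),
    internal_direct_sum (invariants (tensor_action c)) (@irr x y c)
      (@composite_invariants x y c).

Section CanonicalFunctor.
Variable irr : forall x y (c : track_path x y), submodClosed (tensor V c).

Definition irr_family (x y : L0) : lmodType k :=
  dsum (fun c : track_path x y => submod (@irr x y c)).

Hypothesis irrP : irreducible_choice irr.

Fact irr_inclusion_subproof x y (c : track_path x y) (a : submod (@irr x y c)) :
  free_inj V c (val a) \in invariants (homogeneous_action x y).
Proof.
apply/invariantsP => g; rewrite [LHS]free_act_inj.
apply: (congr1 (free_inj V c)).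
suff /invariantsP inv : val a \in invariants (tensor_action c) by exact: inv.
have [dec _] := irrP c; apply/dec; exists (val a), 0.
split; [exact: valP|exact: rpred0|by rewrite addr0].
Qed.

Definition irr_inclusion x y (c : track_path x y) (a : submod (@irr x y c)) :
  @hom k free_fixed_kcat x y := Submod (irr_inclusion_subproof a).

Fact irr_inclusion_linear x y (c : track_path x y) : linear (@irr_inclusion x y c).
Proof. by move=> l a b; apply: val_inj; exact: (linearP (free_inj V c \o val)). Qed.

Definition family_inclusion x y :
    {linear irr_family x y -> @hom k free_fixed_kcat x y} :=
  dsum_lift (fun c => mklin (@irr_inclusion_linear x y c)).

Definition canonical_functor : kfunctor (free_kcat irr_family) free_fixed_kcat :=
  @free_functor k L0 irr_family free_fixed_kcat id family_inclusion.

End CanonicalFunctor.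
End HomogeneousAction.

(* Main.v *)
(* Write T for the free category L_k(V). Bijectivity of F on morphisms is proved
   without any dimension count.
   Surjectivity: by induction on the length, an invariant of W(u) is an irreducible
   one plus a sum of products of shorter invariants.
   Injectivity follows from a stronger fact: basis vectors a_j of the spaces of
   irreducible invariants are left linearly independent over all of T, not only over
   T^G. Suppose sum_j t_j a_j = 0. If no t_j has a component of length 0, peel off
   the leftmost tensor factor of every t_j: this gives shorter relations, so every
   t_j is 0. In general, for each path c, the part of length 0 contributes to the
   component in W(c) an irreducible invariant a, and -a = sum_j t'_j a_j with t'_j of
   positive length. By the first case these t'_j are unique, hence G-invariant, so a
   is also composite, hence 0. *)
From HB Require Import structures.
From mathcomp Require Import all_boot all_algebra all_fingroup.
From mathcomp Require Import all_classical.
Require Import Defs.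

Set Implicit Arguments.
Unset Strict Implicit.
Unset Printing Implicit Defensive.

Import GRing.Theory.
Local Open Scope classical_set_scope.
Local Open Scope ring_scope.


(** * Bases of vector spaces of arbitrary dimension *)

Section Span.
Variables (k : fieldType) (M : lmodType k).

(** The vectors satisfying [P] form a subspace containing [A], so minimality of the span applies. *)
Lemma lspan_ind (A : set M) (P : M -> Prop) : P 0 ->
    (forall x y, P x -> P y -> P (x + y)) -> (forall a x, P x -> P (a *: x)) ->
    (forall x, A x -> P x) -> forall x, x \in lspan A -> P x.
Proof.
move=> P0 PD PZ PA x.
pose S : {pred M} := fun y => `[< P y >].
have S_closed : GRing.subsemimod_closed S.
  split; first split.
  - exact/asboolP.
  - by move=> y z /asboolP Py /asboolP Pz; apply/asboolP/PD.
  - by move=> a y /asboolP Py; apply/asboolP/PZ.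
pose SC := GRing.isSubSemiModClosed.Build k M S S_closed.
pose S' : submodClosed M := HB.pack S SC.
by move=> /(lspan_min (S := S')) xS; apply/asboolP/xS => y /PA ?; exact/asboolP.
Qed.

Lemma lspanS (A B : set M) x : A `<=` B -> x \in lspan A -> x \in lspan B.
Proof. by move=> AB; apply: lspan_min => y /AB; exact: mem_lspan. Qed.

Lemma lspanU1 (A : set M) x y : y \in lspan (A `|` [set x]) ->
  exists a z, z \in lspan A /\ y = a *: x + z.
Proof.
move: y; apply: lspan_ind => [|_ _ [a [z [zA ->]]] [b [t [tA ->]]]|c _ [a [z [zA ->]]]|y].
- by exists 0, 0; rewrite rpred0 scale0r addr0.
- by exists (a + b), (z + t); rewrite rpredD // scalerDl addrACA.
- by exists (c * a), (c *: z); rewrite rpredZ // scalerDr scalerA.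
- case=> [yA|->]; last by exists 1, 0; rewrite rpred0 scale1r addr0.
  by exists 0, y; rewrite mem_lspan // scale0r add0r.
Qed.

(** Linear independence phrased through spans alone, a form that passes easily to unions of
    chains. *)
Definition lfree (A : set M) := forall x, A x -> x \notin lspan (A `\ x).

(** A vector in the span of the union of a chain already lies in the span of one member; the
    induction on the span replaces a choice of finitely many vectors. *)
Lemma lfree_bigcup (F : set (set M)) : (forall A, F A -> lfree A) ->
  total_on F subset -> lfree (\bigcup_(A in F) A).
Proof.
move=> Ffree Ftot x [A0 FA0 A0x]; apply/negP => xspan.
suff [A [FA Ax]] : exists A, [/\ F A, A x & x \in lspan (A `\ x)].
  by apply/negP; exact: Ffree.
suff [A [FA]] : exists A, F A /\ x \in lspan (A `\ x).
  move=> xA; have [A0A|AA0] := Ftot _ _ FA0 FA.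
    by exists A; split=> //; exact: A0A.
  by exists A0; split=> //; apply: lspanS xA => y [/AA0].
(* Only the vector in the span is generalized; the removed vector stays [x]. *)
move: {1 3}x xspan; apply: lspan_ind.
- by exists A0; rewrite rpred0.
- move=> y z [A [FA yA]] [B [FB zB]].
  have [AB|BA] := Ftot _ _ FA FB.
    exists B; split=> //; rewrite rpredD //; apply: lspanS yA => t [At tx].
    by split=> //; exact: AB.
  exists A; split=> //; rewrite rpredD //; apply: lspanS zB => t [At tx].
  by split=> //; exact: BA.
- by move=> a y [A [FA yA]]; exists A; rewrite rpredZ.
- move=> y [[A FA Ay] yx]; exists A; split=> //; exact: mem_lspan.
Qed.

(** Exchange argument: in a dependence of some [y] in [A], a nonzero coefficient of [x] would put
    [x] in the span of [A], and a zero one contradicts freeness of [A]. *)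
Lemma lfreeU1 (A : set M) x : lfree A -> x \notin lspan A -> lfree (A `|` [set x]).
Proof.
move=> Afree xA y Axy; apply/negP => yspan.
have [yx|yx] := pselect (y = x).
  move/negP: xA; apply; rewrite -yx; apply: lspanS yspan => t [[//|/= ->]].
  by rewrite yx.
have Ay : A y by case: Axy.
have [|a [z [zA yE]]] := @lspanU1 (A `\ y) x y.
  apply: lspanS yspan => t [[At|->] ty]; last by right.
  by left; split.
have [a0|a0] := eqVneq a 0.
  by move: yE (Afree y Ay); rewrite a0 scale0r add0r => {1}->; rewrite zA.
move/negP: xA; apply.
have -> : x = a^-1 *: (y - z) by rewrite yE addrK scalerA mulVf // scale1r.
rewrite rpredZ // rpredD //; first exact: mem_lspan.
rewrite -scaleN1r rpredZ //; by apply: lspanS zA => t [].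
Qed.

(** Zorn's lemma gives a maximal free set; a vector outside its span could be adjoined by
    [lfreeU1]. *)
Lemma lfree_max : exists A : set M, lfree A /\ forall x, x \in lspan A.
Proof.
have [A [Afree Amax]] : exists A, lfree A /\ forall B, A `<` B -> ~ lfree B.
  by apply: Zorn_bigcup; exact: lfree_bigcup.
exists A; split=> // x; apply: contrapT => /negP xA.
apply: (Amax (A `|` [set x])); last exact: lfreeU1.
split; first by left.
by move=> sub; move/negP: xA; apply; apply: mem_lspan; apply: sub; right.
Qed.

End Span.

Section FreeModule.
Variable k : fieldType.

Lemma free_module_ind (B : Type) (P : free_module k B -> Prop) : P 0 ->
    (forall x y, P x -> P y -> P (x + y)) -> (forall a x, P x -> P (a *: x)) ->
    (forall b, P (free_basis k b)) -> forall x, P x.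
Proof.
move=> P0 PD PZ Pb; apply: dsum_ind => // b c.
have -> : dinj (fun=> k^o) b c = c *: free_basis k b.
  by rewrite /free_basis -linearZ /= [_ *: _]mulr1.
exact: PZ.
Qed.

Definition lincomb (M : lmodType k) (B : Type) (e : B -> M) :
    {linear free_module k B -> M} :=
  dsum_lift (fun b => mklin (scale_on_linear (e b))).

Lemma lincombE (M : lmodType k) (B : Type) (e : B -> M) b :
  lincomb e (free_basis k b) = e b.
Proof. by rewrite /lincomb dsum_lift_dinj /= scale1r. Qed.

Lemma linear_lincomb (M N : lmodType k) (B : Type) (e : B -> M)
    (f : {linear M -> N}) m : f (lincomb e m) = lincomb (f \o e) m.
Proof.
elim/free_module_ind: m => [|x y ex ey|a x ex|b]; first by rewrite !linear0.
- by rewrite !linearD ex ey.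
- by rewrite !linearZ ex.
- by rewrite !lincombE.
Qed.

Lemma lincombP (M : lmodType k) (B : Type) a (e e' : B -> M) m :
  lincomb (fun b => a *: e b + e' b) m = a *: lincomb e m + lincomb e' m.
Proof.
elim/free_module_ind: m => [|x y ex ey|c x ex|b].
- by rewrite !linear0 addr0.
- by rewrite !(linearD (lincomb _)) ex ey scalerDr addrACA.
- by rewrite !(linearZ_LR (lincomb _)) ex scalerDr !scalerA mulrC.
- by rewrite !lincombE.
Qed.

(** Bases are families indexed by a type, so that they can index direct sums later. *)
Definition is_basis (M : lmodType k) (B : Type) (e : B -> M) :=
  (forall m, lincomb e m = 0 -> m = 0) /\ (forall x, exists m, x = lincomb e m).

Lemma basis_exists (M : lmodType k) : exists (B : Type) (e : B -> M), is_basis e.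
Proof.
have [A [Afree Aspan]] := lfree_max M.
exists {x : M | A x}, (@proj1_sig M A); split=> [m m0|x].
  apply: dsum_ext => b; rewrite linear0; apply/eqP/negPn/negP => mb.
  (* A nonzero coefficient at [b] would express [b] through the other vectors of [A], against
     freeness. *)
  move: m0; rewrite /lincomb /= /dsum_lift_val.
  rewrite (bigD1_seq (b : {classic {x : M | A x}})) ?mem_dsum_support ?uniq_dsum_support //=.
  move=> /eqP; rewrite addr_eq0 => /eqP bE.
  have /negP := Afree _ (proj2_sig b); apply.
  have b1 : proj1_sig b = (dcoord b m)^-1 *: (dcoord b m *: proj1_sig b).
    by rewrite scalerA mulVf // scale1r.
  rewrite [X in X \in _]b1 bE -scaleN1r !rpredZ // rpred_sum // => -[y Ay] /eqP yb.
  rewrite rpredZ // mem_lspan //; split=> //= yE; apply: yb.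
  (* By proof irrelevance, distinct indices carry distinct vectors. *)
  case: b {mb bE b1} yE => z Az /= yE; move: Ay; rewrite yE => Ay.
  by rewrite (Prop_irrelevance Ay Az).
move: x (Aspan x); apply: lspan_ind => [|_ _ [m ->] [n ->]|a _ [m ->]|x Ax].
- by exists 0; rewrite linear0.
- by exists (m + n); rewrite linearD.
- by exists (a *: m); rewrite linearZ.
- by exists (free_basis k (exist _ x Ax)); rewrite lincombE.
Qed.

End FreeModule.

Section BasisCoordinates.
Variables (k : fieldType) (M : lmodType k) (B : Type) (e : B -> M).
Hypothesis eP : is_basis e.

Let coords (x : M) : free_module k B := projT1 (cid (eP.2 x)).
Let coordsK x : lincomb e (coords x) = x.
Proof. by rewrite /coords; case: cid. Qed.

(** Coordinates are picked by choice, but their uniqueness makes the choice linear. *)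
Fact basis_coords_linear : linear coords.
Proof.
move=> a x y; apply/eqP; rewrite -subr_eq0; apply/eqP/eP.1.
by rewrite linearB linearP !coordsK subrr.
Qed.
Definition basis_coords : {linear M -> free_module k B} := mklin basis_coords_linear.

Lemma basis_coordsK x : lincomb e (basis_coords x) = x.
Proof. exact: coordsK. Qed.

End BasisCoordinates.
Arguments dcoord : simpl never.
Arguments dinj : simpl never.

(** * Supports of morphisms of a free category *)

Section DirectSumMap.
Variables (k : fieldType) (I : Type) (M N : I -> lmodType k).
Variable phi : forall i, {linear M i -> N i}.

Definition dsum_map : {linear dsum M -> dsum N} :=
  dsum_lift (fun i => dinj N i \o phi i).

Lemma dsum_map_dinj i m : dsum_map (dinj M i m) = dinj N i (phi i m).
Proof. by rewrite /dsum_map dsum_lift_dinj. Qed.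

Lemma dcoord_dsum_map i f : dcoord i (dsum_map f) = phi i (dcoord i f).
Proof.
elim/dsum_ind: f => [|f g ef eg|j m]; first by rewrite !linear0.
  by rewrite !linearD /= ef eg.
rewrite dsum_map_dinj; have [e|ne] := pselect (j = i).
  by case: _ / e; rewrite !dcoord_dinj.
by rewrite !dcoord_dinj_neq // linear0.
Qed.

End DirectSumMap.

Fact scaler_is_linear (k : fieldType) (M : lmodType k) (c : k) :
  linear (fun x : M => c *: x).
Proof. by move=> a x y; rewrite scalerDr !scalerA mulrC. Qed.

(** Unlike [dsum_linear_ext], this compares the maps at a single [f] through its own components, so
    that hypotheses on these components can be used. *)
Lemma dsum_linear_eq (k : fieldType) (I : Type) (M : I -> lmodType k) (N : lmodType k)
    (F G : {linear dsum M -> N}) (f : dsum M) :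
  (forall i, F (dinj M i (dcoord i f)) = G (dinj M i (dcoord i f))) -> F f = G f.
Proof. by move=> FG; rewrite (dsumE f) !linear_sum; apply: eq_bigr => i _. Qed.

Section Support.
Variables (k : fieldType) (L0 : Type) (V : L0 -> L0 -> lmodType k).

Definition comp_right x y z (a : free_hom V x y) : {linear free_hom V y z -> free_hom V x z} :=
  mklin (@free_comp_linl _ _ _ _ _ _ a).

Definition supported x y (P : oseq x y -> Prop) (t : free_hom V x y) :=
  forall u, dcoord u t != 0 -> P u.

Section Basic.
Variables x y : L0.
Implicit Types (P : oseq x y -> Prop) (t : free_hom V x y).

(** Only components in the support of [t] occur in its decomposition, and each is a combination of
    pure tensors along the same sequence. *)
Lemma supported_ind P (Q : free_hom V x y -> Prop) : Q 0 ->
    (forall a b, Q a -> Q b -> Q (a + b)) -> (forall c a, Q a -> Q (c *: a)) ->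
    (forall u (p : factors V u), P u -> Q (free_mono p)) ->
  forall t, supported P t -> Q t.
Proof.
move=> Q0 QD QZ Qm t Pt; rewrite (dsumE t) big_seq.
apply: (big_ind Q) => // u; rewrite mem_dsum_support => /Pt Pu.
elim/tensor_ind: (dcoord u t) => [|a b Qa Qb|c a Qa|p]; last exact: Qm.
- by rewrite linear0.
- by rewrite linearD; exact: QD.
- by rewrite linearZ; exact: QZ.
Qed.

Lemma supported_ext P (N : lmodType k) (f g : {linear free_hom V x y -> N}) :
    (forall u (p : factors V u), P u -> f (free_mono p) = g (free_mono p)) ->
  forall t, supported P t -> f t = g t.
Proof.
move=> fg; apply: supported_ind => [|a b ea eb|c a ea|//].
- by rewrite !linear0.
- by rewrite (linearD f) (linearD g) ea eb.
- by rewrite (linearZ_LR f) (linearZ_LR g) ea.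
Qed.

Lemma supported0 P : supported P 0.
Proof. by move=> u; rewrite linear0 eqxx. Qed.

Lemma supportedD P t t' : supported P t -> supported P t' -> supported P (t + t').
Proof.
move=> Pt Pt' u; rewrite linearD /=; have [->|/Pt //] := eqVneq (dcoord u t) 0.
by rewrite add0r => /Pt'.
Qed.

Lemma supportedZ P c t : supported P t -> supported P (c *: t).
Proof. by move=> Pt u; rewrite linearZ /= scaler_eq0 negb_or => /andP[_ /Pt]. Qed.

Lemma supported_inj P u (a : tensor V u) : P u -> supported P (free_inj V u a).
Proof.
move=> Pu v; have [<- //|ne] := pselect (u = v).
by rewrite /free_inj dcoord_dinj_neq ?eqxx.
Qed.

Lemma supportedB P t t' : supported P t -> supported P t' -> supported P (t - t').
Proof.
move=> Pt Pt'; rewrite -scaleN1r; apply: (supportedD Pt); exact: supportedZ Pt'.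
Qed.

Lemma supported_sub P P' t : (forall u, P u -> P' u) -> supported P t -> supported P' t.
Proof. by move=> PP' Pt u /Pt /PP'. Qed.

Lemma supported_dcoord0 P t u : supported P t -> ~ P u -> dcoord u t = 0.
Proof. by move=> Pt Pu; apply/eqP/negPn/negP => /Pt. Qed.

(** Truncation to the components in [P], encoded as scaling by 0 or 1 so that linearity comes from
    [dsum_map]. *)
Definition sproj P : {linear free_hom V x y -> free_hom V x y} :=
  dsum_map (fun u => mklin (scaler_is_linear `[< P u >]%:R)).

Lemma dcoord_sproj P t u : dcoord u (sproj P t) = `[< P u >]%:R *: dcoord u t.
Proof. exact: dcoord_dsum_map. Qed.

Lemma dcoord_sproj_in P t u : P u -> dcoord u (sproj P t) = dcoord u t.
Proof. by move=> /asboolP Pu; rewrite dcoord_sproj Pu scale1r. Qed.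

Lemma sproj_inj P u (a : tensor V u) :
  sproj P (free_inj V u a) = free_inj V u (`[< P u >]%:R *: a).
Proof. by rewrite [LHS]dsum_map_dinj. Qed.

Lemma supported_sproj P t : supported P (sproj P t).
Proof. by move=> u; rewrite dcoord_sproj; case: asboolP; rewrite // scale0r eqxx. Qed.

Lemma supported_sprojW P P' t : supported P t -> supported P (sproj P' t).
Proof.
move=> Pt u; rewrite dcoord_sproj; case: asboolP => _; last by rewrite scale0r eqxx.
by rewrite scale1r => /Pt.
Qed.

Lemma sproj_split P P' t :
  sproj P t = sproj (fun u => P u /\ P' u) t + sproj (fun u => P u /\ ~ P' u) t.
Proof.
apply: dsum_ext => u; rewrite (linearD (dcoord u)).
have out Q : ~ Q u -> dcoord u (sproj Q t) = 0.
  by move=> nQu; apply: supported_dcoord0 nQu; exact: supported_sproj.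
have [Pu|nPu] := pselect (P u); last first.
  by rewrite out // [X in X + _]out ?[X in _ + X]out ?addr0 // => -[].
have [P'u|nP'u] := pselect (P' u).
  rewrite [X in _ + X]out ?addr0; last by case.
  by rewrite [LHS]dcoord_sproj_in // [RHS]dcoord_sproj_in.
rewrite [X in X + _]out ?add0r; last by case.
by rewrite [LHS]dcoord_sproj_in // [RHS]dcoord_sproj_in.
Qed.

Lemma free_inj_injective u : injective (free_inj V u : tensor V u -> free_hom V x y).
Proof. by move=> a b /(congr1 (dcoord u)); rewrite /free_inj !dcoord_dinj. Qed.

End Basic.

Lemma supported_map x y x' y' (f : {linear free_hom V x y -> free_hom V x' y'})
    (P : oseq x y -> Prop) (P' : oseq x' y' -> Prop) :
    (forall u (p : factors V u), P u -> supported P' (f (free_mono p))) ->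
  forall t, supported P t -> supported P' (f t).
Proof.
move=> Pf; apply: supported_ind => [|a b Pa Pb|c a Pa|//].
- by rewrite linear0; exact: supported0.
- by rewrite (linearD f); exact: supportedD.
- by rewrite (linearZ_LR f); exact: supportedZ.
Qed.

(** Right multiplication by an element of W(u) carries the component along [v] to the one along
    [ocat v u], so truncating the product amounts to truncating the left factor. *)
Lemma sproj_comp x y z (P : oseq x z -> Prop) (t : free_hom V y z) (u : oseq x y)
    (a : tensor V u) :
  sproj P (free_comp t (free_inj V u a)) =
  free_comp (sproj (fun v => P (ocat v u)) t) (free_inj V u a).
Proof.
move: t; apply: (dsum_linear_ext (f := sproj P \o comp_right z (free_inj V u a))
  (g := comp_right z (free_inj V u a) \o sproj (fun v => P (ocat v u)))) => v b.
rewrite -[LHS]/(sproj P (free_comp (free_inj V v b) _)).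
rewrite -[RHS]/(free_comp (sproj _ (free_inj V v b)) _).
rewrite free_comp_inj !sproj_inj free_comp_inj; congr (free_inj _ _ _).
by rewrite [RHS](linearZ_LR (mklin (@tmul_linl _ _ V _ _ _ v u a))).
Qed.

Definition bounded n x y : free_hom V x y -> Prop := supported (fun u => olength u <= n)%N.
Definition positive x y : free_hom V x y -> Prop := supported (fun u => 0 < olength u)%N.

Lemma bounded_exists x y (t : free_hom V x y) : exists n, bounded n t.
Proof.
move: t; apply: free_hom_ind => [|a b [m am] [n bn]|c a [n an]|u p].
- by exists 0%N; exact: supported0.
- exists (maxn m n); apply: supportedD.
    by apply: supported_sub am => u /leq_trans; apply; exact: leq_maxl.
  by apply: supported_sub bn => u /leq_trans; apply; exact: leq_maxr.
- by exists n; exact: supportedZ.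
- by exists (olength u); exact: supported_inj.
Qed.

Lemma bounded_positive0 x y (t : free_hom V x y) : bounded 0 t -> positive t -> t = 0.
Proof.
move=> b0 p0; apply: dsum_ext => u; rewrite linear0; apply/eqP/negPn/negP => tu.
by move: (b0 u tu) (p0 u tu); rewrite leqn0 => /eqP ->.
Qed.

End Support.
(** * Left derivatives *)

Section LeftDerivative.
Variables (k : fieldType) (L0 : Type) (V : L0 -> L0 -> lmodType k).
Variables (B : L0 -> L0 -> Type) (e : forall x y, B x y -> V x y).
Hypothesis eP : forall x y, is_basis (@e x y).

(* The entry t at (y, b) stands for b (x) t, so this is the direct sum over y of
   the spaces V y z (x) T(x, y). *)
Definition derivatives (x z : L0) : lmodType k :=
  dsum (fun j : {y : L0 & B y z} => free_hom V x (projT1 j)).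

Definition derivative_inj x y z (b : B y z) : {linear free_hom V x y -> derivatives x z} :=
  dinj (fun j : {y : L0 & B y z} => free_hom V x (projT1 j)) (existT _ y b).

(** The tensor v (x) s in coordinates: the entry at [b] is [s] scaled by the coordinate of [v] at
    [b]. *)
Definition left_part_fun x y z (v : V y z) (s : free_hom V x y) : derivatives x z :=
  lincomb (fun b => derivative_inj x b s) (basis_coords (@eP y z) v).

Fact left_part_linear x y z (v : V y z) : linear (@left_part_fun x y z v).
Proof.
move=> a s t; rewrite /left_part_fun -lincombP; congr (lincomb _ _).
by apply/funext => b; rewrite linearP.
Qed.
Definition left_part x y z (v : V y z) : {linear free_hom V x y -> derivatives x z} :=
  mklin (@left_part_linear x y z v).

Lemma left_partE x y z (v : V y z) s :
  left_part x v s = lincomb (fun b => derivative_inj x b s) (basis_coords (@eP y z) v).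
Proof. by []. Qed.

Lemma left_part_linearl x y z s : linear (fun v : V y z => left_part x v s).
Proof. by move=> a v w; rewrite /= /left_part_fun !linearP. Qed.

(** The singleton sequence has no leftmost factor; because of the default value 0, the rules below
    are stated for [positive] morphisms. *)
Definition left_der_factors x z (u : oseq x z) : factors V u -> derivatives x z :=
  match u in oseq _ z return factors V u -> derivatives x z with
  | onil => fun _ => 0
  | ocons y z u' => fun p => left_part x p.1 (free_mono p.2)
  end.

Fact left_der_factors_multilinear x z (u : oseq x z) : multilinear (@left_der_factors x z u).
Proof.
case: u => //= y z' u; split=> [q|v]; first exact: left_part_linearl.
exact: (@multilinear_linear _ _ _ _ _ _ _ _ (left_part x v \o free_inj V u) _
  (@pure_multilinear _ _ V _ _ u)).
Qed.

Definition left_der x z : {linear free_hom V x z -> derivatives x z} :=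
  dsum_lift (fun u => tensor_lift (@left_der_factors_multilinear x z u)).

Lemma left_der_mono x z (u : oseq x z) (p : factors V u) :
  left_der x z (free_mono p) = left_der_factors p.
Proof. by rewrite /left_der dsum_lift_dinj tensor_liftE. Qed.

Lemma free_mono_ocons x y z (u : oseq x y) (v : V y z) (p : factors V u) :
  free_mono ((v, p) : factors V (ocons z u)) = free_comp (free_gen v) (free_mono p).
Proof. by rewrite free_comp_mono. Qed.

Lemma left_der_gen x y z (v : V y z) (s : free_hom V x y) :
  left_der x z (free_comp (free_gen v) s) = left_part x v s.
Proof.
move: s; apply: free_hom_ext => [c s t|c s t|u p].
- by rewrite free_comp_linr linearP.
- exact: linearP.
- by rewrite -free_mono_ocons left_der_mono.
Qed.

Definition left_mul x z : {linear derivatives x z -> free_hom V x z} :=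
  dsum_lift (fun j => mklin (@free_comp_linr _ _ _ x _ _ (free_gen (e (projT2 j))))).

(** Multiplying each derivative by its basis vector puts the leftmost factor back, so a positive
    morphism is determined by its derivatives. *)
Lemma left_derK x z (t : free_hom V x z) : positive t -> left_mul x z (left_der x z t) = t.
Proof.
move: t; apply: (supported_ext (f := left_mul x z \o left_der x z) (g := idfun)) => u p.
case: u p => // y z' u [v p] _; rewrite free_mono_ocons.
rewrite -[LHS]/(left_mul x z' (left_der x z' _)) left_der_gen left_partE linear_lincomb.
(* The first factor is expanded in the basis [ev] of its space; [g] carries this expansion to the
   product. *)
pose g : {linear V y z' -> free_hom V x z'} :=
  comp_right z' (free_mono p) \o mklin (@free_gen_linear _ _ V y z').
rewrite -[in RHS](basis_coordsK (@eP y z') v) -[RHS]/(g _) linear_lincomb.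
by congr (lincomb _ _); apply/funext => b; rewrite [LHS]dsum_lift_dinj.
Qed.

(** The leftmost factor of the product belongs to [t] when [t] is positive, so peeling it off
    commutes with right multiplication by [a]. *)
Lemma left_der_comp w x z (t : free_hom V x z) (a : free_hom V w x) : positive t ->
  left_der w z (free_comp t a) =
  dsum_map (fun j => comp_right (projT1 j) a) (left_der x z t).
Proof.
move: t; apply: (supported_ext (f := left_der w z \o comp_right z a)
  (g := dsum_map (fun j => comp_right (projT1 j) a) \o left_der x z)) => u p.
case: u p => // y z' u [v p] _; rewrite free_mono_ocons.
rewrite -[RHS]/(dsum_map _ (left_der x z' _)) left_der_gen.
rewrite -[LHS]/(left_der w z' (free_comp _ _)) -free_compA left_der_gen.
rewrite !left_partE linear_lincomb.
by congr (lincomb _ _); apply/funext => b; rewrite [RHS]dsum_map_dinj.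
Qed.

Lemma bounded_lincomb n x y (A : Type) (f : A -> free_hom V x y) m :
  (forall b, bounded n (f b)) -> bounded n (lincomb f m).
Proof.
elim/free_module_ind: m => [|a b|c a|b]; last by rewrite lincombE; apply.
- by move=> _; rewrite (linear0 (lincomb f)); exact: supported0.
- move=> fa fb fn; rewrite (linearD (lincomb f)).
  by apply: supportedD; [exact: fa | exact: fb].
- by move=> fa /fa; rewrite (linearZ_LR (lincomb f)); exact: supportedZ.
Qed.

(** This drop of the length bound drives the induction behind [recomb_injective]. *)
Lemma bounded_left_der n x z (t : free_hom V x z) j :
  bounded n.+1 t -> bounded n (dcoord j (left_der x z t)).
Proof.
move: t; apply: (supported_map (f := dcoord j \o left_der x z)) => u p.
rewrite -[X in supported _ X]/(dcoord j (left_der x z _)).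
rewrite left_der_mono; case: u p j => [p j _|y z' u [v p] j un].
  by rewrite (linear0 (dcoord j)); exact: supported0.
rewrite /left_der_factors left_partE linear_lincomb; apply: bounded_lincomb => b.
rewrite -[X in bounded _ X]/(dcoord j (dinj _ _ _)).
have [<-|ne] := pselect (existT _ y b = j).
  by rewrite dcoord_dinj; exact: supported_inj.
by rewrite dcoord_dinj_neq //; exact: supported0.
Qed.

End LeftDerivative.
(** * Left independence of the irreducible invariants *)

Section Recomposition.
Variables (gT : finGroupType) (k : fieldType) (L0 : Type).
Variable V : L0 -> L0 -> lmodType k.
Variable rho : forall x y, linear_action gT (V x y).
Variable irr : forall x y (c : track_path V x y), submodClosed (tensor V c).
Hypothesis irrP : irreducible_choice rho irr.
Variable B : forall x y (c : track_path V x y), Type.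
Variable e : forall x y (c : track_path V x y), B c -> submod (irr c).
Hypothesis eP : forall x y (c : track_path V x y), is_basis (@e x y c).

Local Notation cofactor_index x := {y : L0 & {c : track_path V x y & B c}}.
Variables (Bv : L0 -> L0 -> Type) (ev : forall x y, Bv x y -> V x y).
Hypothesis evP : forall x y, is_basis (@ev x y).

Lemma track_path_eq x y (c d : track_path V x y) : c = d :> oseq x y -> c = d.
Proof.
case: c d => [u p a] [v q b] /= uv; case: _ / uv q b => q b.
by rewrite (Prop_irrelevance p q) (Prop_irrelevance a b).
Qed.

(* The direct sum over the paths c from x to y of T(y, z) (x) irr c, with respect
   to the chosen basis of irr c. *)
Definition cofactors (x z : L0) : lmodType k :=
  dsum (fun j : cofactor_index x => free_hom V (projT1 j) z).

Definition irr_elt x (j : cofactor_index x) : free_hom V x (projT1 j) :=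
  free_inj V (projT1 (projT2 j)) (val (e (projT2 (projT2 j)))).

(** Injectivity of this map is the left independence of the basis irreducibles over all of T. *)
Definition recomb x z : {linear cofactors x z -> free_hom V x z} :=
  dsum_lift (fun j => comp_right z (irr_elt j)).

Lemma recomb_inj x z j t : recomb x z (dinj _ j t) = free_comp t (irr_elt j).
Proof. by rewrite /recomb dsum_lift_dinj. Qed.

Lemma irr_invariant x y (c : track_path V x y) (a : submod (irr c)) :
  val a \in invariants (tensor_action rho c).
Proof.
have [dec _] := irrP c; apply/dec; exists (val a), 0.
by split; [exact: valP|exact: rpred0|rewrite addr0].
Qed.

Lemma free_act_irr g x y (c : track_path V x y) (a : submod (irr c)) :
  free_act rho g x y (free_inj V c (val a)) = free_inj V c (val a).
Proof.
rewrite free_act_inj; congr (free_inj _ _ _).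
exact: (invariantsP _ _ (irr_invariant a) g).
Qed.

(** * Group action and projections on cofactors *)

Definition cofactors_act g x z : {linear cofactors x z -> cofactors x z} :=
  dsum_map (fun j => free_act rho g (projT1 j) z).

(** The elements [irr_elt j] are fixed by the group, so it acts on a product through the cofactor
    alone. *)
Lemma recomb_act g x z (f : cofactors x z) :
  recomb x z (cofactors_act g x z f) = free_act rho g x z (recomb x z f).
Proof.
move: f; apply: (dsum_linear_ext (f := recomb x z \o cofactors_act g x z)
  (g := free_act rho g x z \o recomb x z)) => j t.
rewrite -[LHS]/(recomb x z (cofactors_act g x z _)).
rewrite -[RHS]/(free_act rho g x z (recomb x z _)).
by rewrite [cofactors_act _ _ _ _]dsum_map_dinj !recomb_inj free_act_comp free_act_irr.
Qed.

Lemma supported_act g x y (P : oseq x y -> Prop) (t : free_hom V x y) :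
  supported P t -> supported P (free_act rho g x y t).
Proof.
move: t; apply: (supported_map (f := free_act rho g x y)) => u p Pu.
by rewrite free_act_inj; exact: supported_inj.
Qed.

Lemma dcoord_act g x y (u : oseq x y) (t : free_hom V x y) :
  dcoord u (free_act rho g x y t) = tensor_act rho g u (dcoord u t).
Proof.
move: t; apply: (dsum_linear_ext (f := dcoord u \o free_act rho g x y)
  (g := tensor_act rho g u \o dcoord u)) => v a.
rewrite -[LHS]/(dcoord u (free_act rho g x y (free_inj V v a))).
rewrite -[RHS]/(tensor_act rho g u (dcoord u _)) free_act_inj /free_inj.
have [vu|ne] := pselect (v = u); first by case: _ / vu; rewrite !dcoord_dinj.
by rewrite !dcoord_dinj_neq // linear0.
Qed.

Definition cofactors_proj x z
    (P : forall j : cofactor_index x, oseq (projT1 j) z -> Prop) :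
    {linear cofactors x z -> cofactors x z} :=
  dsum_map (fun j => sproj V (P j)).

Definition path_of x (j : cofactor_index x) : oseq x (projT1 j) :=
  projT1 (projT2 j).

(** Allows a relation among the irreducibles to be restricted to its component along one path. *)
Lemma proj_recomb x z (P : oseq x z -> Prop) (f : cofactors x z) :
  sproj V P (recomb x z f) =
  recomb x z (cofactors_proj (fun j v => P (ocat v (path_of j))) f).
Proof.
move: f; apply: (dsum_linear_ext (f := sproj V P \o recomb x z)
  (g := recomb x z \o cofactors_proj (fun j v => P (ocat v (path_of j))))) => j t.
rewrite -[LHS]/(sproj V P (recomb x z _)) -[RHS]/(recomb x z (cofactors_proj _ _)).
by rewrite [cofactors_proj _ _]dsum_map_dinj !recomb_inj sproj_comp.
Qed.

(** Cofactors of length 0 at the single path [c]: scalar multiples of the identity of [z]. *)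
Definition unit_cofactors x z (c : track_path V x z) :
    {linear free_module k (B c) -> cofactors x z} :=
  lincomb (fun b => dinj (fun j : cofactor_index x => free_hom V (projT1 j) z)
    (existT _ z (existT _ c b)) (free_id V z)).

Lemma recomb_unit x z (c : track_path V x z) m :
  recomb x z (unit_cofactors c m) = free_inj V c (val (lincomb (@e x z c) m)).
Proof.
pose i : {linear submod (irr c) -> free_hom V x z} := free_inj V c \o val.
rewrite -[RHS]/(i _) !linear_lincomb; congr (lincomb _ _); apply/funext => b.
by rewrite [LHS]recomb_inj [LHS]free_comp1l.
Qed.

(** If [v] has length 0, the concatenation equals [c] only when the path of [j] is [c] itself, and
    the cofactor is then a scalar. *)
Lemma proj_unit x z (c : track_path V x z) (f : cofactors x z) : exists m,
  cofactors_proj (fun j v => ocat v (path_of j) = c /\ (olength v <= 0)%N) f =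
  unit_cofactors c m.
Proof.
pose P (j : cofactor_index x) (v : oseq (projT1 j) z) :=
  ocat v (path_of j) = c /\ (olength v <= 0)%N.
rewrite -/P; elim/dsum_ind: f => [|f g [m mE] [n nE]|j t].
- by exists 0; rewrite (linear0 (cofactors_proj P)) (linear0 (unit_cofactors c)).
- exists (m + n).
  by rewrite (linearD (cofactors_proj P)) (linearD (unit_cofactors c)) mE nE.
rewrite [cofactors_proj _ _]dsum_map_dinj.
pose h : {linear free_hom V (projT1 j) z -> cofactors x z} :=
    dinj (fun j : cofactor_index x => free_hom V (projT1 j) z) j \o sproj V (P j).
suff: exists m, h t = unit_cofactors c m by [].
move: t; apply: free_hom_ind => [|s t [m mE] [n nE]|a s [m mE]|v p].
- by exists 0; rewrite [LHS](linear0 h) (linear0 (unit_cofactors c)).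
- by exists (m + n); rewrite [LHS](linearD h) (linearD (unit_cofactors c)) mE nE.
- by exists (a *: m); rewrite [LHS](linearZ_LR h) (linearZ_LR (unit_cofactors c)) mE.
rewrite -[h _]/(dinj _ j (sproj V (P j) (free_inj V v (pure p)))) sproj_inj.
case: asboolP => [|_]; last first.
  exists 0; rewrite scale0r (linear0 (free_inj V v)).
  by rewrite (linear0 (dinj _ j)) (linear0 (unit_cofactors c)).
(* Now [v] must be [onil], the path [d] is [c], and the scalar 1 sits at the basis vector [b]. *)
rewrite scale1r {h}; case: j @P v p => y [d b] P v p [] {P}.
rewrite /path_of /=; case: v c p => [|//] c [] /= /track_path_eq dc _.
case: _ / dc; exists (free_basis k b).
by rewrite [RHS]lincombE.
Qed.

(** The action preserves components, so each component of an invariant cofactor is invariant; it has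
    positive length, and its product with an irreducible invariant is composite by definition. *)
Lemma recomb_composite x z (u : oseq x z) (h : cofactors x z) :
    (forall j, supported (fun v => ocat v (path_of j) = u /\ (0 < olength v)%N) (dcoord j h)) ->
    (forall g j, free_act rho g _ _ (dcoord j h) = dcoord j h) ->
  exists w, w \in composite_invariants rho (u := u) /\ recomb x z h = free_inj V u w.
Proof.
move=> hsupp hinv.
pose Q s := exists w, w \in composite_invariants rho (u := u) /\ s = free_inj V u w.
have Q0 : Q 0 by exists 0; rewrite rpred0 linear0.
have QD s t : Q s -> Q t -> Q (s + t).
  move=> [w [wc ->]] [w' [wc' ->]].
  by exists (w + w'); rewrite rpredD // (linearD (free_inj V u)).
rewrite -/(Q _) (dsumE h) linear_sum; apply: (big_ind Q) => // j _.
rewrite recomb_inj -[free_comp _ _]/(comp_right z (irr_elt j) _).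
move: (hsupp j) (hinv ^~ j); set t := dcoord j h => tsupp tinv.
rewrite (dsumE t) linear_sum big_seq; apply: (big_ind Q) => // v.
rewrite mem_dsum_support => /tsupp [vu vpos].
rewrite -[comp_right _ _ _]/(free_comp (free_inj V v (dcoord v t)) (irr_elt j)).
rewrite [free_comp _ _]free_comp_inj /Q; case: _ / vu.
exists (tmul (dcoord v t) (val (e (projT2 (projT2 j))))); split=> //.
apply: (@mem_lspan _ _ (composite_product rho (u := _))).
apply: CompositeProduct => //.
- exact: track_pos.
- by apply/invariantsP => g; rewrite -[LHS](dcoord_act g v t) tinv.
- exact: irr_invariant.
Qed.

(** * Left independence by induction on the length of the cofactors *)

Lemma cofactors_der_inj x z (f : cofactors x z) j (i : {y : L0 & Bv y z}) :
  positive (dcoord j f) ->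
  recomb x (projT1 i) (dinj _ j (dcoord i (left_der evP _ _ (dcoord j f)))) =
  dcoord i (left_der evP x z (recomb x z (dinj _ j (dcoord j f)))).
Proof.
by move=> fpos; rewrite !recomb_inj left_der_comp // [RHS]dcoord_dsum_map.
Qed.

Definition cofactors_der x z (i : {y : L0 & Bv y z}) :
    {linear cofactors x z -> cofactors x (projT1 i)} :=
  dsum_map (fun j => dcoord i \o left_der evP (projT1 j) z).

Lemma dcoord_cofactors_der x z (i : {y : L0 & Bv y z}) (f : cofactors x z) j :
  dcoord j (cofactors_der x i f) = dcoord i (left_der evP _ _ (dcoord j f)).
Proof. exact: dcoord_dsum_map. Qed.

(** Derivatives of positive cofactors commute with right multiplication by the irreducibles, so a
    relation yields shorter relations among the same irreducibles. *)
Lemma recomb_der x z (i : {y : L0 & Bv y z}) (f : cofactors x z) :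
    (forall j, positive (dcoord j f)) ->
  recomb x _ (cofactors_der x i f) = dcoord i (left_der evP x z (recomb x z f)).
Proof.
move=> fpos; apply: (dsum_linear_eq (F := recomb x _ \o cofactors_der x i)
  (G := dcoord i \o (left_der evP x z \o recomb x z))) => j.
have := cofactors_der_inj i (fpos j).
suff <- : cofactors_der x i (dinj _ j (dcoord j f)) =
    dinj _ j (dcoord i (left_der evP _ _ (dcoord j f))) by [].
exact: dsum_map_dinj.
Qed.

(** Two forms proved in alternation: this one at [n] gives the positive one at [n.+1], which gives
    this one at [n.+1]. *)
Definition recomb_injective_upto x n := forall z (f : cofactors x z),
  (forall j, bounded n (dcoord j f)) -> recomb x z f = 0 -> f = 0.

Definition recomb_injective_positive x n := forall z (f : cofactors x z),
  (forall j, bounded n (dcoord j f)) -> (forall j, positive (dcoord j f)) ->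
  recomb x z f = 0 -> f = 0.

(** Every derivative of the relation is a relation with bound [n], hence trivial; by [left_derK] the
    positive cofactors vanish with their derivatives. *)
Lemma recomb_injective_positiveS x n :
  recomb_injective_upto x n -> recomb_injective_positive x n.+1.
Proof.
move=> inj z f fn fpos f0; apply: dsum_ext => j.
rewrite (linear0 (dcoord j)) -(left_derK evP (fpos j)).
suff -> : left_der evP _ _ (dcoord j f) = 0 by rewrite (linear0 (left_mul _ _ _)).
apply: dsum_ext => i; rewrite -(dcoord_cofactors_der i f j) (linear0 (dcoord i)).
suff -> : cofactors_der x i f = 0 by rewrite (linear0 (dcoord j)).
apply: inj => [l|]; first by rewrite dcoord_cofactors_der; exact: bounded_left_der.
by rewrite recomb_der // f0 (linear0 (left_der _ _ _)) (linear0 (dcoord i)).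
Qed.

Lemma cofactors_proj_split x z P P' (f : cofactors x z) :
  cofactors_proj P f = cofactors_proj (fun j v => P j v /\ P' j v) f +
                       cofactors_proj (fun j v => P j v /\ ~ P' j v) f.
Proof.
apply: dsum_ext => j; rewrite (linearD (dcoord j)).
rewrite [LHS]dcoord_dsum_map [X in _ = X + _]dcoord_dsum_map [X in _ = _ + X]dcoord_dsum_map.
exact: (sproj_split (P j) (P' j)).
Qed.

(* If a length-0 part were nonzero for the path c, its recombination would be an
   invariant of the irreducible part of W(c) and also the recombination of positive
   cofactors; by uniqueness these are invariant, so the element is composite. *)
Lemma proj_unit0 x z n (c : track_path V x z) (f : cofactors x z) :
    recomb_injective_positive x n -> (forall j, bounded n (dcoord j f)) ->
    recomb x z f = 0 ->
  cofactors_proj (fun j v => ocat v (path_of j) = c /\ (olength v <= 0)%N) f = 0.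
Proof.
move=> inj fn f0.
pose P (j : cofactor_index x) (v : oseq (projT1 j) z) :=
  ocat v (path_of j) = c.
(* The component along [c] of the relation is a relation by itself; [m] and [h] are its parts of
   length 0 and of positive length. *)
have E : recomb x z (cofactors_proj P f) = 0.
  by rewrite -(proj_recomb (fun u => u = c)) f0 (linear0 (sproj V _)).
have [m mE] := proj_unit c f.
pose h := cofactors_proj (fun j v => P j v /\ ~ (olength v <= 0)%N) f.
have mh : free_inj V c (val (lincomb (@e x z c) m)) = - recomb x z h.
  apply/eqP; rewrite -addr_eq0 -recomb_unit -mE -(linearD (recomb x z)); apply/eqP.
  apply: etrans E; congr (recomb x z _); apply: esym; exact: cofactors_proj_split.
rewrite [LHS]mE.
have hsupp j : supported (fun v => ocat v (path_of j) = c /\ (0 < olength v)%N) (dcoord j h).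
  rewrite [dcoord j h]dcoord_dsum_map.
  apply: (supported_sub _ (@supported_sproj _ _ V _ _ _ _)) => v.
  by rewrite ltnNge => -[-> /negP].
have hn j : bounded n (dcoord j h).
  by rewrite [dcoord j h]dcoord_dsum_map; apply: supported_sprojW; exact: fn.
have hpos j : positive (dcoord j h) by apply: supported_sub (hsupp j) => v [].
(* Both [h] and its translate are positive and recombine to the same invariant vector, so [inj]
   kills their difference. *)
have hinv g : cofactors_act g x z h = h.
  apply/eqP; rewrite -subr_eq0; apply/eqP; apply: inj => [j|j|].
  - rewrite (linearB (dcoord j)) [X in bounded _ (X - _)]dcoord_dsum_map.
    by apply: supportedB; [apply: supported_act; exact: hn | exact: hn].
  - rewrite (linearB (dcoord j)) [X in positive (X - _)]dcoord_dsum_map.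
    by apply: supportedB; [apply: supported_act; exact: hpos | exact: hpos].
  rewrite (linearB (recomb x z)) recomb_act.
  have -> : recomb x z h = - free_inj V c (val (lincomb (@e x z c) m)) by rewrite mh opprK.
  by rewrite (linearN (free_act _ _ _ _)) free_act_irr subrr.
have [|w [wc hw]] := recomb_composite hsupp.
  by move=> g j; rewrite -[in RHS](hinv g) [RHS]dcoord_dsum_map.
have [_ dis] := irrP c.
have m0 : val (lincomb (@e x z c) m) = 0.
  apply: dis; first exact: valP.
  suff -> : val (lincomb (@e x z c) m) = - w by rewrite -scaleN1r rpredZ.
  by apply: (@free_inj_injective _ _ V); rewrite mh hw (linearN (free_inj V c)).
rewrite ((@eP x z c).1 m) ?(linear0 (unit_cofactors c)) //.
exact: val_inj.
Qed.

(** Applied to the path of each index, [proj_unit0] kills the component of the cofactor along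
    [onil], the only sequence of length 0; so all cofactors are positive. *)
Lemma recomb_injective_positive_upto x n :
  recomb_injective_positive x n -> recomb_injective_upto x n.
Proof.
move=> inj z f fn f0; apply: (inj z f fn _ f0) => -[y [c b]]; rewrite /positive /supported /= => v.
rewrite lt0n; apply: contraNneq => v0; apply/eqP.
case: v v0 f fn f0 => // _ f fn f0; set j := existT _ _ _.
have := proj_unit0 c inj fn f0 => /(congr1 (dcoord j)).
rewrite dcoord_dsum_map (linear0 (dcoord j)) => /(congr1 (dcoord onil)).
by rewrite dcoord_sproj_in // (linear0 (dcoord _)).
Qed.

(** The alternation starts at bound 0, where positive morphisms vanish. An arbitrary [f] has
    finitely many nonzero cofactors, hence a common length bound. *)
Lemma recomb_injective x z (f : cofactors x z) : recomb x z f = 0 -> f = 0.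
Proof.
have inj n : recomb_injective_upto x n.
  elim: n => [|n IH]; apply: recomb_injective_positive_upto.
    move=> y g g0 gpos _; apply: dsum_ext => j.
    by rewrite (linear0 (dcoord j)); exact: bounded_positive0.
  exact: recomb_injective_positiveS.
suff [n fn] : exists n, forall j, bounded n (dcoord j f) by exact: inj fn.
elim/dsum_ind: f => [|f g [m fm] [n gn]|j t].
- by exists 0%N => j; rewrite (linear0 (dcoord j)); exact: supported0.
- exists (maxn m n) => j; rewrite (linearD (dcoord j)); apply: supportedD.
    by apply: supported_sub (fm j) => u /leq_trans; apply; exact: leq_maxl.
  by apply: supported_sub (gn j) => u /leq_trans; apply; exact: leq_maxr.
have [n tn] := bounded_exists t; exists n => i.
have [ji|ne] := pselect (j = i); first by case: _ / ji; rewrite dcoord_dinj.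
by rewrite dcoord_dinj_neq //; exact: supported0.
Qed.

End Recomposition.
(** * The canonical functor *)

Section FreeCategoryFacts.
Variables (k : fieldType) (L0 : Type) (V : L0 -> L0 -> lmodType k).

Lemma olength_ocat (x y z : L0) (w : oseq y z) (u : oseq x y) :
  olength (ocat w u) = (olength w + olength u)%N.
Proof. by elim: w => //= s t w ->. Qed.

Lemma positive_comp x y z (t : free_hom V y z) (u : oseq x y) (a : tensor V u) :
  (0 < olength u)%N -> positive (free_comp t (free_inj V u a)).
Proof.
move=> upos; have : supported (fun=> True) t by [].
move: t; apply: (supported_map (f := comp_right z (free_inj V u a))) => v p _.
rewrite -[X in supported _ X]/(free_comp (free_inj V v (pure p)) (free_inj V u a)).
by rewrite free_comp_inj; apply: supported_inj; rewrite olength_ocat ltn_addl.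
Qed.

(** Sequences grow at the left end, so reaching the rightmost factor takes an induction. *)
Lemma free_mono_rsplit n x z (u : oseq x z) (p : factors V u) : olength u = n.+1 ->
  exists y (w : V x y) (u' : oseq y z) (q : factors V u'),
    olength u' = n /\ free_mono p = free_comp (free_mono q) (free_gen w).
Proof.
elim: u n p => //= y {}z u IH n [v p] [un]; case: n un => [|n] un.
  case: u {IH} v p un => //= v [] _.
  by exists z, v, onil, tt; split=> //; rewrite [RHS]free_comp1l.
have [y' [w [u' [q [u'n pq]]]]] := IH n p un.
exists y', w, (ocons z u'), (v, q); split; first by rewrite /= u'n.
by rewrite !free_mono_ocons pq free_compA.
Qed.

(** The constant 1 on the empty tuple is multilinear and induces a linear form that separates the
    identity from 0. *)
Lemma free_id_neq0 x : free_id V x != 0.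
Proof.
apply/eqP => /(congr1 (dcoord onil)); rewrite /free_id /free_mono /free_inj dcoord_dinj.
rewrite (linear0 (dcoord onil)).
pose f : factors V (@onil _ x) -> k^o := fun=> 1.
move=> /(congr1 (tensor_lift (I : multilinear f))); rewrite tensor_liftE.
by rewrite (linear0 (tensor_lift _)) => /eqP; rewrite oner_eq0.
Qed.

(** A sequence of length 0 forces its endpoints to agree; the identity is transported along a proof
    of [x = z], and the case [t = 0] covers distinct endpoints. *)
Lemma bounded0P x z (t : free_hom V x z) : bounded 0 t ->
  t = 0 \/ exists (xz : x = z) c, t = eq_rect x (free_hom V x) (c *: free_id V x) z xz.
Proof.
move: t; apply: supported_ind => [|s t|a t|u p].
- by left.
- move=> [->|[xz [c sE]]] [->|[xz' [d tE]]]; rewrite ?addr0 ?add0r; try by left.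
  + by right; exists xz', d.
  + by right; exists xz, c.
  right; exists xz, (c + d); rewrite sE tE (Prop_irrelevance xz' xz).
  by case: _ / xz {sE tE xz'}; rewrite scalerDl.
- move=> [->|[xz [c tE]]]; first by left; rewrite scaler0.
  right; exists xz, (a * c); rewrite tE.
  by case: _ / xz {tE}; rewrite /= scalerA.
case: u p => // -[] _; right; exists erefl, 1.
by rewrite /= scale1r.
Qed.

(** A step without an arrow has zero space, and a pure tensor with a zero factor vanishes; only
    paths of the track-quiver contribute. *)
Lemma free_mono_eq0 x y (u : oseq x y) (p : factors V u) :
  ~ all_steps (track_arrow V) u -> free_mono p = 0.
Proof.
elim: u p => [|y' z u IH] p /=; first by case.
case: p => v p; rewrite free_mono_ocons => nsteps.
have [v0|v0] := eqVneq v 0.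
  rewrite v0; pose f : {linear V y' z -> free_hom V x z} :=
    comp_right z (free_mono p) \o mklin (@free_gen_linear _ _ V y' z).
  exact: (linear0 f).
rewrite IH => [|steps]; first exact: (linear0 (mklin (free_comp_linr (free_gen v)))).
by apply: nsteps; split=> //; exists v.
Qed.

Lemma free_inj_eq0 x y (u : oseq x y) (a : tensor V u) :
  ~ all_steps (track_arrow V) u -> free_inj V u a = 0.
Proof.
move=> nsteps; elim/tensor_ind: a => [|a b a0 b0|c a a0|p].
- by rewrite (linear0 (free_inj V u)).
- by rewrite (linearD (free_inj V u)) a0 b0 addr0.
- by rewrite (linearZ_LR (free_inj V u)) a0 scaler0.
- exact: free_mono_eq0.
Qed.

End FreeCategoryFacts.

Section CanonicalFunctor.
Variables (gT : finGroupType) (k : fieldType) (L0 : Type).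
Variable V : L0 -> L0 -> lmodType k.
Variable rho : forall x y, linear_action gT (V x y).
Variable irr : forall x y (c : track_path V x y), submodClosed (tensor V c).
Hypothesis irrP : irreducible_choice rho irr.
Local Notation U := (irr_family irr).

(** Composing the functor with the inclusion of the invariants allows computations to take place in
    T. *)
Fact realize_linear x y :
  linear (fun f : free_hom U x y => val (fmap (canonical_functor irrP) f) : free_hom V x y).
Proof. by move=> a f g; rewrite fmap_lin. Qed.
Definition realize x y : {linear free_hom U x y -> free_hom V x y} :=
  mklin (@realize_linear x y).

Lemma realize_id x : realize x x (free_id U x) = free_id V x.
Proof. exact: (congr1 val (fmap1 (canonical_functor irrP) x)). Qed.

Lemma realize_comp x y z (g : free_hom U y z) (f : free_hom U x y) :
  realize x z (free_comp g f) = free_comp (realize y z g) (realize x y f).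
Proof. exact: (congr1 val (fmapM (canonical_functor irrP) g f)). Qed.

Definition irr_gen x y (c : track_path V x y) (a : submod (irr c)) : free_hom U x y :=
  free_gen (dinj (fun c : track_path V x y => submod (irr c)) c a : U x y).

Lemma realize_gen x y (c : track_path V x y) (a : submod (irr c)) :
  realize x y (irr_gen a) = free_inj V c (val a).
Proof.
rewrite -[LHS]/(val (fmap (canonical_functor irrP) (irr_gen a))).
by rewrite [fmap _ _]free_functor_gen [family_inclusion _ _ _ _]dsum_lift_dinj.
Qed.

(** * Surjectivity on morphisms *)

Lemma realize_surj_composite n x y (u : oseq x y) (t : tensor V u) :
    (forall x y (v : oseq x y) (a : tensor V v), (olength v < n)%N ->
      a \in invariants (tensor_action rho v) -> exists f, free_inj V v a = realize x y f) ->
  composite_product rho (u := u) t -> (olength u < n.+1)%N ->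
  exists f, free_inj V u t = realize x y f.
Proof.
move=> IH [] {u t}y y' w u a b wpos upos ainv binv; rewrite olength_ocat ltnS => wun.
(* Both factors have positive length, so each is shorter than [u] and [IH] applies. *)
have [f fE] : exists f, free_inj V w a = realize y y' f.
  by apply: IH => //; apply: leq_trans wun; rewrite -addn1 leq_add2l.
have [g gE] : exists g, free_inj V u b = realize x y g.
  by apply: IH => //; apply: leq_trans wun; rewrite -add1n leq_add2r.
by exists (free_comp f g); rewrite realize_comp -fE -gE free_comp_inj.
Qed.

Lemma realize_surj_inj x y (u : oseq x y) (a : tensor V u) :
  a \in invariants (tensor_action rho u) -> exists f, free_inj V u a = realize x y f.
Proof.
have [n] := ubnP (olength u); elim: n x y u a => // n IH x y u a un ainv.
have Q0 : exists f, free_inj V u 0 = realize x y f.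
  by exists 0; rewrite (linear0 (free_inj V u)) (linear0 (realize x y)).
have QD s t : (exists f, free_inj V u s = realize x y f) ->
    (exists f, free_inj V u t = realize x y f) ->
    exists f, free_inj V u (s + t) = realize x y f.
  move=> [f fE] [g gE]; exists (f + g).
  by rewrite (linearD (free_inj V u)) (linearD (realize x y)) fE gE.
have QZ c s : (exists f, free_inj V u s = realize x y f) ->
    exists f, free_inj V u (c *: s) = realize x y f.
  move=> [f fE]; exists (c *: f).
  by rewrite (linearZ_LR (free_inj V u)) (linearZ_LR (realize x y)) fE.
(* In length 0 every vector is a multiple of an identity. *)
have [/eqP u0|upos] := posnP (olength u).
  move: a {ainv}; apply: tensor_ind => // p.
  case: u p u0 {un Q0 QD QZ} => // -[] _.
  by exists (free_id U x); rewrite realize_id.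
(* Irreducible invariants are chosen only on paths of the track-quiver; along any other sequence the
   vector is 0. *)
have [steps|nsteps] := pselect (all_steps (track_arrow V) u); last first.
  by exists 0; rewrite (linear0 (realize x y)) free_inj_eq0.
pose c := TrackPath upos steps.
have [/(_ a) [/(_ ainv) [i [w [ii wc ->]]] _] _] := irrP c.
apply: (QD); first by exists (irr_gen (Submod ii)); rewrite realize_gen.
move: w wc; apply: lspan_ind => // t tP.
exact: (realize_surj_composite IH tP un).
Qed.

(** The action preserves components, so each component of an invariant morphism is invariant. *)
Lemma realize_surj x y (t : free_hom V x y) :
  (forall g, free_act rho g x y t = t) -> exists f, t = realize x y f.
Proof.
move=> tinv; pose Q s := exists f, s = realize x y f.
rewrite -/(Q _) (dsumE t); apply: (big_ind Q) => [|s s' [f ->] [g ->]|u _].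
- by exists 0; rewrite (linear0 (realize x y)).
- by exists (f + g); rewrite (linearD (realize x y)).
apply: realize_surj_inj; apply/invariantsP => g.
by rewrite -[LHS](dcoord_act rho g u t) tinv.
Qed.

(** * Injectivity on morphisms *)

Section Bases.
Variable B : forall x y (c : track_path V x y), Type.
Variable e : forall x y (c : track_path V x y), B c -> submod (irr c).
Hypothesis eP : forall x y (c : track_path V x y), is_basis (@e x y c).
Local Notation cofactor_index x := {y : L0 & {c : track_path V x y & B c}}.
Variables (Bv : L0 -> L0 -> Type) (ev : forall x y, Bv x y -> V x y).
Hypothesis evP : forall x y, is_basis (@ev x y).

(** Counterpart of [cofactors] over the free category on [U], where the generators replace the
    irreducible invariants. *)
Definition free_cofactors (x z : L0) : lmodType k :=
  dsum (fun j : cofactor_index x => free_hom U (projT1 j) z).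

Definition free_recomb x z : {linear free_cofactors x z -> free_hom U x z} :=
  dsum_lift (fun j => comp_right z (irr_gen (e (projT2 (projT2 j))))).

Definition realize_cofactors x z : {linear free_cofactors x z -> cofactors B x z} :=
  dsum_map (fun j => realize (projT1 j) z).

(** The functor sends each generator to its irreducible invariant, so relations in its kernel come
    under [recomb_injective]. *)
Lemma realize_recomb x z (h : free_cofactors x z) :
  realize x z (free_recomb x z h) = recomb e x z (realize_cofactors x z h).
Proof.
move: h; apply: (dsum_linear_ext (f := realize x z \o free_recomb x z)
  (g := recomb e x z \o realize_cofactors x z)) => j t.
have L := dsum_lift_dinj (fun j : cofactor_index x =>
  comp_right z (irr_gen (e (projT2 (projT2 j))))) t.
have R := dsum_map_dinj (fun j : cofactor_index x =>
  realize (projT1 j) z) t.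
apply: etrans (congr1 (realize x z) L) _; apply: etrans (realize_comp _ _) _.
apply: esym; apply: etrans (congr1 (recomb e x z) R) _.
by rewrite recomb_inj realize_gen.
Qed.

Lemma recomb_positive x z (h : cofactors B x z) : positive (recomb e x z h).
Proof.
rewrite (dsumE h) linear_sum; apply: (big_ind (@positive _ _ _ _ _)) => [|s t|j _].
- exact: supported0.
- by move=> spos tpos; apply: supportedD; [exact: spos | exact: tpos].
by rewrite recomb_inj; apply: positive_comp; exact: track_pos.
Qed.

(** Expanding [w] in the chosen bases gives every basis vector a scalar multiple of [t] as cofactor,
    which keeps the bound. *)
Lemma free_comp_gen_recomb n x y z (t : free_hom U y z) (w : U x y) : bounded n t ->
  exists h : free_cofactors x z, (forall j, bounded n (dcoord j h)) /\
    free_comp t (free_gen w) = free_recomb x z h.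
Proof.
move=> tn; pose l : {linear U x y -> free_hom U x z} :=
  mklin (free_comp_linr t) \o mklin (@free_gen_linear _ _ U x y).
pose Q s := exists h : free_cofactors x z,
  (forall j, bounded n (dcoord j h)) /\ s = free_recomb x z h.
have Q0 : Q 0.
  exists 0; split=> [j|]; last by rewrite (linear0 (free_recomb x z)).
  by rewrite (linear0 (dcoord j)); exact: supported0.
have QD s s' : Q s -> Q s' -> Q (s + s').
  move=> [h [hn ->]] [h' [hn' ->]]; exists (h + h').
  split=> [j|]; last exact: esym (linearD (free_recomb x z) h h').
  by rewrite (linearD (dcoord j)); apply: supportedD; [exact: hn | exact: hn'].
have QZ c s : Q s -> Q (c *: s).
  move=> [h [hn ->]]; exists (c *: h).
  split=> [j|]; last exact: esym (linearZ_LR (free_recomb x z) c h).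
  by rewrite (linearZ_LR (dcoord j)); apply: supportedZ; exact: hn.
suff: Q (l w) by [].
elim/dsum_ind: w => [|v w Qv Qw|c a].
- by rewrite (linear0 l).
- by rewrite (linearD l); exact: QD.
have [m ->] := (eP c).2 a.
pose lc : {linear submod (irr c) -> free_hom U x z} := l \o dinj _ c.
suff: Q (lc (lincomb (@e x y c) m)) by [].
elim/free_module_ind: m => [|m m' Qm Qm'|a' m Qm|b].
- by rewrite (linear0 (lincomb _)) (linear0 lc).
- by rewrite (linearD (lincomb _)) (linearD lc); exact: QD.
- by rewrite (linearZ_LR (lincomb _)) (linearZ_LR lc); exact: QZ.
rewrite lincombE; pose j : cofactor_index x := existT _ y (existT _ c b).
exists (dinj (fun j => free_hom U (projT1 j) z) j t); split=> [i|].
  have [<-|ne] := pselect (j = i); first by rewrite dcoord_dinj.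
  by rewrite dcoord_dinj_neq //; exact: supported0.
by rewrite [RHS]dsum_lift_dinj.
Qed.

(** Terms of length 0 go into [d]; in the others the rightmost generator is split off, and the rest,
    of length at most [n], becomes a cofactor. *)
Lemma free_recomb_split n x z (f : free_hom U x z) : bounded n.+1 f ->
  exists d (h : free_cofactors x z), [/\ bounded 0 d,
    forall j, bounded n (dcoord j h) & f = d + free_recomb x z h].
Proof.
move: f; apply: supported_ind => [|f g|c f|u p un].
- exists 0, 0; split=> [|j|]; first exact: supported0; last first.
    by rewrite (linear0 (free_recomb x z)) addr0.
  by rewrite (linear0 (dcoord j)); exact: supported0.
- move=> [d [h [d0 hn ->]]] [d' [h' [d0' hn' ->]]]; exists (d + d'), (h + h').
  split=> [|j|]; first by apply: supportedD; [exact: d0 | exact: d0'].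
    by rewrite (linearD (dcoord j)); apply: supportedD; [exact: hn | exact: hn'].
  by rewrite addrACA; congr (_ + _); exact: esym (linearD (free_recomb x z) h h').
- move=> [d [h [d0 hn ->]]]; exists (c *: d), (c *: h).
  split=> [|j|]; first exact: supportedZ d0; last first.
    by rewrite scalerDr; congr (_ + _); exact: esym (linearZ_LR (free_recomb x z) c h).
  by rewrite (linearZ_LR (dcoord j)); apply: supportedZ; exact: hn.
case uE: (olength u) un => [|m] un.
  exists (free_mono p), 0; split=> [|j|]; first by apply: supported_inj; rewrite uE.
    by rewrite (linear0 (dcoord j)); exact: supported0.
  by rewrite (linear0 (free_recomb x z)) addr0.
have [y [w [v [q [vm ->]]]]] := free_mono_rsplit p uE.
have [|h [hn ->]] := @free_comp_gen_recomb n x y z (free_mono q) w.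
  by apply: supported_inj; rewrite vm.
by exists 0, h; split=> //; [exact: supported0 | rewrite add0r].
Qed.

(** Length 0 leaves only scalar multiples of an identity, and the functor sends identities to
    nonzero identities. *)
Lemma realize_bounded0 x z (d : free_hom U x z) : bounded 0 d ->
  bounded 0 (realize x z d) /\ (realize x z d = 0 -> d = 0).
Proof.
move=> d0; have [->|[xz [c ->]]] := bounded0P d0.
  by rewrite (linear0 (realize x z)); split=> //; exact: supported0.
case: _ / xz; change (bounded 0 (realize x x (c *: free_id U x)) /\
  (realize x x (c *: free_id U x) = 0 -> c *: free_id U x = 0)).
rewrite (linearZ_LR (realize x x)) realize_id; split.
  by apply: supportedZ; exact: supported_inj.
move=> /eqP; rewrite scaler_eq0 (negbTE (free_id_neq0 _ _)) orbF => /eqP ->.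
by rewrite scale0r.
Qed.

(** Induction on the length in the generators: left independence of the irreducibles shows that each
    cofactor of [f] is in the kernel, and these cofactors are shorter. *)
Lemma realize_injective x z (f : free_hom U x z) : realize x z f = 0 -> f = 0.
Proof.
have [n] := bounded_exists f; elim: n x z f => [|n IH] x z f fn f0.
  by have [_] := realize_bounded0 fn; exact.
have [d [h [d0 hn fE]]] := free_recomb_split fn.
have [rd0 rdI] := realize_bounded0 d0.
have rdE : realize x z d = - recomb e x z (realize_cofactors x z h).
  by apply/eqP; rewrite -addr_eq0 -realize_recomb -(linearD (realize x z)) -fE f0.
(* This image has length 0, and it is also positive as the negative of a recombination. *)
have rd : realize x z d = 0.
  apply: bounded_positive0 => //; rewrite rdE -scaleN1r.
  by apply: supportedZ; exact: recomb_positive.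
have h0 : realize_cofactors x z h = 0.
  apply: (recomb_injective irrP eP evP).
  by apply/eqP; rewrite -oppr_eq0 -rdE rd.
rewrite fE rdI // add0r; suff -> : h = 0 by rewrite (linear0 (free_recomb x z)).
apply: dsum_ext => j; rewrite (linear0 (dcoord j)); apply: IH; first exact: hn.
rewrite -[LHS](dcoord_dsum_map (fun j => realize (projT1 j) z) j h).
by rewrite -/(realize_cofactors x z) h0 (linear0 (dcoord j)).
Qed.

End Bases.

(** * The inverse functor *)

Lemma canonical_functor_isomorphism : isomorphism (canonical_functor irrP).
Proof.
set F := canonical_functor irrP.
have surj x y (t : @hom k (free_fixed_kcat rho) x y) :
    exists f : @hom k (free_kcat U) x y, fmap F f = t.
  have [|f fE] := @realize_surj x y (val t).
    by move=> g; exact: (invariantsP _ _ (valP t) g).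
  by exists f; apply: val_inj; rewrite fE.
have inj x y : injective (@fmap k _ _ F x y).
  move=> f g fg; apply/eqP; rewrite -subr_eq0; apply/eqP.
  pose irr_basis x y (c : track_path V x y) := cid (basis_exists (submod (irr c))).
  pose V_basis x y := cid (basis_exists (V x y)).
  apply: (realize_injective (fun x y c => projT2 (cid (projT2 (irr_basis x y c))))
    (fun x y => projT2 (cid (projT2 (V_basis x y))))).
  rewrite (linearB (realize x y)); apply/eqP; rewrite subr_eq0; apply/eqP.
  exact: (congr1 val fg).
(* Preimages are picked by choice; injectivity makes them unique, hence linear and compatible with
   identities and composition. *)
pose inv x y t : @hom k (free_kcat U) x y := projT1 (cid (surj x y t)).
have invK x y t : fmap F (inv x y t) = t by rewrite /inv; case: cid.
have inv_lin x y : linear (inv x y).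
  by move=> a s t; apply: inj; rewrite fmap_lin !invK.
have inv1 x : inv x x (kid (free_fixed_kcat rho) x) = kid (free_kcat U) x.
  by apply: inj; rewrite invK fmap1.
have invM x y z (t : @hom k (free_fixed_kcat rho) y z) (s : @hom k (free_fixed_kcat rho) x y) :
    inv x z (kcomp _ t s) = kcomp (free_kcat U) (inv y z t) (inv x y s).
  by apply: inj; rewrite fmapM !invK.
exists (@Kfunctor k (free_fixed_kcat rho) (free_kcat U) id inv inv_lin inv1 invM).
split; apply: kfunctor_ext => x y f; last exact: invK.
by apply: inj; exact: invK.
Qed.

End CanonicalFunctor.

Theorem theorem4p1 (k : fieldType) (gT : finGroupType) (L0 : Type)
    (V : L0 -> L0 -> vectType k)
    (rho : forall x y : L0, linear_action gT (V x y))
    (irr : forall (x y : L0) (c : track_path V x y), submodClosed (tensor V c))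
    (irrP : irreducible_choice rho irr) :
  isomorphism (canonical_functor irrP).
Proof. exact: canonical_functor_isomorphism. Qed.
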